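(* Let $n\ge 3$ be an integer, let $V=\mathbb{Z}^2$ and $V^*=\operatorname{Hom}_{\mathbb Z}(V,\mathbb{Z})$. Let $R$ be a commutative ring and $I$ an $R$-module. The following are equivalent. (1) $R$ and $I$ are associated to a binary $n$-ic form, i.e. there is a binary $n$-ic form $f$ with integer coefficients, a ring isomorphism $R\cong \mathcal{R}_f$, and an isomorphism of $I$ with $\mathcal{I}_{f,n-3}$ compatible with that ring isomorphism. (2) There exist an isomorphism of $\mathbb{Z}$-modules $R/\mathbb{Z}\cong \operatorname{Sym}_{n-2}V^*$ and an exact sequence of $\mathbb{Z}$-modules $0\to \operatorname{Sym}^{n-3}V\to I\to V^*\to 0$ such that the map $\operatorname{Sym}_{n-2}V^*\otimes \operatorname{Sym}^{n-3}V\to V^*$ given by the action of $R$ on $I$ is the natural map between those $\mathbb{Z}$-modules. (3) $R$ has a $\mathbb{Z}$-module basis $\zeta_0=1,\zeta_1,\dots,\zeta_{n-1}$ and $I$ has a $\mathbb{Z}$-module basis $\alpha_1,\alpha_2,\beta_1,\dots,\beta_{n-2}$ such that for all $i\in\{1,2\}$, $0\le j\le n-1$, $1\le k\le n-2$, the $\alpha_i$-coefficient of $\zeta_j\beta_k$ is $1$ if $i+j+k=n+1$ and $0$ otherwise.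
   Context: A binary $n$-ic form over $\mathbb{Z}$ is $f=f_0x^n+f_1x^{n-1}y+\dots+f_ny^n$ with $f_i\in\mathbb{Z}$ (possibly $f=0$). Regard $f$ as a map $\mathcal{O}(-n)\to\mathcal{O}$ on $\mathbb{P}^1_{\mathbb Z}$. Define $\mathcal{R}_f=H^0\big(\mathbb{P}^1_{\mathbb Z},\mathcal{O}(-n)\xrightarrow{f}\mathcal{O}\big)$ and $\mathcal{I}_{f,k}=H^0\big(\mathbb{P}^1_{\mathbb Z},\mathcal{O}(-n+k)\xrightarrow{f}\mathcal{O}(k)\big)$ (hypercohomology; complexes in degrees $-1$ and $0$). $\mathcal{R}_f$ is a ring via the product of complexes $\mathcal{O}\otimes\mathcal{O}\to\mathcal{O}$, $\mathcal{O}\otimes\mathcal{O}(-n)\to\mathcal{O}(-n)$, $\mathcal{O}(-n)\otimes\mathcal{O}(-n)\to 0$, and $\mathcal{I}_{f,k}$ is an $\mathcal{R}_f$-module via the analogous natural action of complexes. When $f\neq 0$, with $S_f\subset\mathbb{P}^1_{\mathbb Z}$ the subscheme cut out by $f$, these are just $\mathcal{R}_f=\Gamma(S_f,\mathcal{O}_{S_f})$ and $\mathcal{I}_{f,k}=\Gamma(S_f,\mathcal{O}_{S_f}(k))$, where $\mathcal O_{S_f}(k)$ is the pullback of $\mathcal O(k)$ to $S_f$. $\operatorname{Sym}^mM$ is the usual quotient of $M^{\otimes m}$; $\operatorname{Sym}_mM$ is the submodule of symmetric tensors in $M^{\otimes m}$. One has $\operatorname{Sym}^mV\cong(\operatorname{Sym}_mV^*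 )^*$, where $v_1\cdots v_m$ sends $t\in\operatorname{Sym}_mV^*\subset (V^* )^{\otimes m}$ to $t(v_1,\dots,v_m)$. The natural map $\operatorname{Sym}_{n-2}V^*\otimes\operatorname{Sym}^{n-3}V\to V^*$ is the inclusion $\operatorname{Sym}_{n-2}V^*\subset V^*\otimes\operatorname{Sym}_{n-3}V^*$ followed by this pairing of $\operatorname{Sym}_{n-3}V^*$ with $\operatorname{Sym}^{n-3}V$. $R/\mathbb{Z}$ is the quotient of $R$ by the image of $\mathbb{Z}$. The map in (2) given by the action is induced by $R\otimes \operatorname{Sym}^{n-3}V\to I\to V^*$, $r\otimes k\mapsto$ image of $rk$ in $V^*$; it factors through $R/\mathbb{Z}$. *)

(* Defs.v *)
From HB Require Import structures.
From mathcomp Require Import all_boot all_order all_fingroup all_algebra.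
From mathcomp Require Import fraction generic_quotient ring_quotient boolp.
From mathcomp Require Import mpoly.
From mathcomp Require Import ring zify.

Set Implicit Arguments.
Unset Strict Implicit.
Unset Printing Implicit Defensive.

Import GRing.Theory.
Local Open Scope ring_scope.
Local Open Scope quotient_scope.

Notation Kxy := {fraction {mpoly int[2]}}.
Local Notation "p %:F" := (tofrac p).

Definition varx : {mpoly int[2]} := 'X_(@Ordinal 2 0 isT).
Definition vary : {mpoly int[2]} := 'X_(@Ordinal 2 1 isT).

(* For h homogeneous of degree e, Gamma(D_+(h), O(k)) is the degree k part of
   Z[x,y]_h; it is realised inside Frac Z[x,y], so that restriction maps are
   inclusions. *)
Definition sections (e : nat) (h : {mpoly int[2]}) (k : int) : pred Kxy :=
  fun s => `[< exists (m d : nat) (g : {mpoly int[2]}),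
    [/\ d%:Z = k + (m * e)%N%:Z, g \is d.-homog & s = g%:F / h%:F ^+ m] >].

Definition sec_x (k : int) := sections 1 varx k.
Definition sec_y (k : int) := sections 1 vary k.
Definition sec_xy (k : int) := sections 2 (varx * vary) k.

Lemma mpolyXU_neq0 (i : 'I_2) : ('X_i : {mpoly int[2]}) != 0.
Proof. by rewrite -msupp_eq0 msuppX. Qed.

Lemma varx_neq0 : varx != 0. Proof. exact: mpolyXU_neq0. Qed.
Lemma vary_neq0 : vary != 0. Proof. exact: mpolyXU_neq0. Qed.
Lemma varxy_neq0 : varx * vary != 0.
Proof. by rewrite mulf_neq0 ?varx_neq0 ?vary_neq0. Qed.

Lemma varx_homog : varx \is 1.-homog.
Proof. by rewrite dhomogX; apply/eqP; exact: mdeg1. Qed.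
Lemma vary_homog : vary \is 1.-homog.
Proof. by rewrite dhomogX; apply/eqP; exact: mdeg1. Qed.
Lemma varxy_homog : varx * vary \is 2.-homog.
Proof. exact: dhomogM varx_homog vary_homog. Qed.

Lemma divX_sub (F : fieldType) (g g' h : F) (m m' : nat) : h != 0 ->
  g / h ^+ m - g' / h ^+ m' = (g * h ^+ m' - g' * h ^+ m) / h ^+ (m + m').
Proof.
move=> h0; rewrite exprD; have := expf_neq0 m h0; have := expf_neq0 m' h0.
by move: (h ^+ m) (h ^+ m') => a b ha hb; field; rewrite ha hb.
Qed.

Lemma divX_mul (F : fieldType) (g g' h : F) (m m' : nat) :
  (g / h ^+ m) * (g' / h ^+ m') = (g * g') / h ^+ (m + m').
Proof. by rewrite exprD invfM mulrACA. Qed.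

Section Sections.
Variables (e : nat) (h : {mpoly int[2]}).
Hypotheses (e0 : (0 < e)%N) (h0 : h != 0) (hh : h \is e.-homog).

Lemma sections_zmod k : zmod_closed (sections e h k).
Proof.
split.
  apply/asboolP; exists (absz k), (absz (k + (absz k * e)%N%:Z)), 0.
  by split; rewrite ?rpred0 ?rmorph0 ?mul0r //; nia.
move=> s t /asboolP[m [d [g [Ed gd ->]]]] /asboolP[m' [d' [g' [Ed' gd' ->]]]].
apply/asboolP; exists (m + m')%N, (d + m' * e)%N, (g * h ^+ m' - g' * h ^+ m).
split; first by move: Ed Ed'; rewrite mulnDl !PoszD; lia.
  have hm i : h ^+ i \is (i * e).-homog by rewrite mulnC; exact: dhomogMn.
  apply: rpredB; first by apply: dhomogM => //; exact: hm.
  have -> : (d + m' * e = d' + m * e)%N by lia.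
  by apply: dhomogM => //; exact: hm.
by rewrite divX_sub ?tofrac_eq0 // rmorphB !rmorphM !rmorphXn.
Qed.

Lemma sections_mul k l s t :
  sections e h k s -> sections e h l t -> sections e h (k + l) (s * t).
Proof using.
move=> /asboolP[m [d [g [Ed gd ->]]]] /asboolP[m' [d' [g' [Ed' gd' ->]]]].
apply/asboolP; exists (m + m')%N, (d + d')%N, (g * g').
by split; [move: Ed Ed'; rewrite mulnDl !PoszD; clear; lia | exact: dhomogM | rewrite divX_mul rmorphM].
Qed.

Lemma sections_poly (d : nat) (p : {mpoly int[2]}) :
  p \is d.-homog -> sections e h d p%:F.
Proof using.
by move=> pd; apply/asboolP; exists 0%N, d, p; rewrite mul0n addr0 expr0 divr1.
Qed.

End Sections.

HB.instance Definition _ k :=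
  GRing.isZmodClosed.Build Kxy (sec_x k)
    (@sections_zmod 1 _ isT varx_neq0 varx_homog k).
HB.instance Definition _ k :=
  GRing.isZmodClosed.Build Kxy (sec_y k)
    (@sections_zmod 1 _ isT vary_neq0 vary_homog k).
HB.instance Definition _ k :=
  GRing.isZmodClosed.Build Kxy (sec_xy k)
    (@sections_zmod 2 _ isT varxy_neq0 varxy_homog k).

Lemma sec_xM k l s t :
  s \in sec_x k -> t \in sec_x l -> s * t \in sec_x (k + l).
Proof. exact: sections_mul. Qed.
Lemma sec_yM k l s t :
  s \in sec_y k -> t \in sec_y l -> s * t \in sec_y (k + l).
Proof. exact: sections_mul. Qed.
Lemma sec_xyM k l s t :
  s \in sec_xy k -> t \in sec_xy l -> s * t \in sec_xy (k + l).
Proof. exact: sections_mul. Qed.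

Lemma sections_res (h h' : {mpoly int[2]}) k s :
  h' != 0 -> h' \is 1.-homog ->
  s \in sections 1 h k -> s \in sections 2 (h * h') k.
Proof.
move=> h0 hd /asboolP[m [d [g [Ed gd ->]]]].
apply/asboolP; exists m, (d + 1 * m)%N, (g * h' ^+ m); split.
- by lia.
- by apply: dhomogM => //; exact: dhomogMn.
rewrite !rmorphM rmorphXn exprMn -mulf_div divff ?mulr1 //.
by rewrite expf_neq0 // tofrac_eq0.
Qed.

Lemma sec_x_xy k s : s \in sec_x k -> s \in sec_xy k.
Proof. exact: sections_res vary_neq0 vary_homog. Qed.
Lemma sec_y_xy k s : s \in sec_y k -> s \in sec_xy k.
Proof. by rewrite /sec_xy mulrC; exact: sections_res varx_neq0 varx_homog. Qed.

(* The coefficient f i is the one of x^(n-i) y^i. *)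
Definition binary_form (n : nat) : Type := {ffun 'I_n.+1 -> int}.

Definition form_poly (n : nat) (f : binary_form n) : {mpoly int[2]} :=
  \sum_(i < n.+1) f i *: (varx ^+ (n - i) * vary ^+ i).

Lemma form_homog n (f : binary_form n) : form_poly f \is n.-homog.
Proof.
apply: rpred_sum => i _; apply: rpredZ.
have {4}-> : n = (1 * (n - i) + 1 * i)%N by have := ltn_ord i; lia.
by apply: dhomogM; apply: dhomogMn; [exact: varx_homog | exact: vary_homog].
Qed.

Lemma tripleB (U V W : zmodType) (a a' : U) (b b' : V) (c c' : W) :
  (a, b, c) - (a', b', c') = (a - a', b - b', c - c').
Proof. by []. Qed.

Lemma subrACA (U : zmodType) (a b c d : U) : (a - b) - (c - d) = (a - c) - (b - d).
Proof. by rewrite !opprB addrACA [RHS]addrACA [- b - c]addrC. Qed.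

Section CupIdentities.
Variables (A : comNzRingType) (F a x y a' x' y' cx cy : A).

Lemma cup_cocycle_id : y - x = F * a -> y' - x' = F * a' ->
  y * y' - x * x' = F * (a * y' + x * a').
Proof. by move=> E E'; rewrite mulrDr mulrA -E mulrCA -E'; ring. Qed.

Lemma cupC_id : y - x = F * a -> y' - x' = F * a' ->
  a * y' + x * a' = a' * y + x' * a.
Proof.
move=> /(canRL (subrK _)) -> /(canRL (subrK _)) ->; ring.
Qed.

Lemma cup_cobl_id : y - x = F * a ->
  (cy - cx) * y + F * cx * a = cy * y - cx * x.
Proof. by move=> E; rewrite mulrAC -E; ring. Qed.

Lemma cup_cobr_id : y - x = F * a ->
  a * (F * cy) + x * (cy - cx) = y * cy - x * cx.
Proof. by move=> E; rewrite mulrCA mulrA -E; ring. Qed.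
End CupIdentities.

(* The hypercohomology H^0(P^1, O(-n+k) --f--> O(k)) is H^0 of the total Cech
   complex for the affine cover D_+(x), D_+(y).  A 0-cochain is (a, bx, by) with
   a a section of O(k-n) over D_+(xy) and bx, by sections of O(k) over D_+(x),
   D_+(y); it is a cocycle iff by - bx = f a.  The coboundary of a (-1)-cochain
   (cx, cy) of O(k-n) is (cy - cx, f cx, f cy). *)
Section Cech.
Variables (n : nat) (f : binary_form n).
Local Notation F := ((form_poly f)%:F : Kxy).

Definition is_cocycle (k : int) : pred (Kxy * Kxy * Kxy) := fun u =>
  [&& u.1.1 \in sec_xy (k - n%:Z), u.1.2 \in sec_x k, u.2 \in sec_y k
    & u.2 - u.1.2 == F * u.1.1].

Lemma is_cocycle_zmod k : zmod_closed (is_cocycle k).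
Proof.
split; first by apply/and4P; split; rewrite /= ?rpred0 // mulr0 subrr.
move=> [[a bx] by_] [[a' bx'] by'] /and4P[/= ha hx hy /eqP E].
move=> /and4P[/= ha' hx' hy' /eqP E'].
rewrite tripleB; apply/and4P; rewrite /=; split.
- exact: rpredB ha ha'.
- exact: rpredB hx hx'.
- exact: rpredB hy hy'.
by rewrite mulrBr -E -E' subrACA.
Qed.

HB.instance Definition _ k :=
  GRing.isZmodClosed.Build (Kxy * Kxy * Kxy)%type (is_cocycle k)
    (is_cocycle_zmod k).

Record cocycle (k : int) : Type :=
  Cocycle { cocycle_val :> Kxy * Kxy * Kxy; _ : is_cocycle k cocycle_val }.

HB.instance Definition _ k := [isSub for @cocycle_val k].
HB.instance Definition _ k := [Choice of cocycle k by <:].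
HB.instance Definition _ k := [SubChoice_isSubZmodule of cocycle k by <:].

Definition is_coboundary (k : int) : pred (cocycle k) := fun u =>
  `[< exists cx cy : Kxy,
      [/\ cx \in sec_x (k - n%:Z), cy \in sec_y (k - n%:Z)
        & cocycle_val u = (cy - cx, F * cx, F * cy)] >].

Lemma is_coboundary_zmod k : zmod_closed (@is_coboundary k).
Proof.
split.
  apply/asboolP; exists 0, 0; split; rewrite ?rpred0 // !mulr0 subrr.
  by rewrite -[cocycle_val _]/(val (0 : cocycle k)) raddf0.
move=> u v /asboolP[cx [cy [hx hy E]]] /asboolP[cx' [cy' [hx' hy' E']]].
apply/asboolP; exists (cx - cx'), (cy - cy').
split; [exact: rpredB hx hx' | exact: rpredB hy hy' | ].
rewrite -[cocycle_val _]/(val (u - v)) raddfB /= E E'.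
by rewrite tripleB !mulrBr subrACA.
Qed.

HB.instance Definition _ k :=
  GRing.isZmodClosed.Build (cocycle k) (@is_coboundary k)
    (is_coboundary_zmod k).

Definition coboundaries (k : int) : zmodClosed (cocycle k) :=
  GRing.ZmodClosed.clone (cocycle k) (@is_coboundary k) _.

Definition H0 (k : int) : Type := Quotient.quot (coboundaries k).
HB.instance Definition _ k := GRing.Zmodule.on (H0 k).
HB.instance Definition _ k := EqQuotient.on (H0 k).

Lemma H0_surj k (x : H0 k) : exists u : cocycle k, x = \pi_(H0 k) u.
Proof. by exists (repr x); rewrite reprK. Qed.

Lemma H0_eqP k (u v : cocycle k) :
  reflect (\pi_(H0 k) u = \pi_(H0 k) v) (is_coboundary (u - v)).
Proof.
apply: (iffP idP) => [h|/eqP].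
  by apply/eqP; rewrite -(Quotient.idealrBE (coboundaries k)).
by rewrite -(Quotient.idealrBE (coboundaries k)).
Qed.

Lemma H0_piB k : zmod_morphism (\pi_(H0 k) : cocycle k -> H0 k).
Proof. exact: (pi_is_zmod_morphism (Quotient.quot (coboundaries k))). Qed.

HB.instance Definition _ k :=
  GRing.isZmodMorphism.Build (cocycle k) (H0 k) (\pi_(H0 k)) (@H0_piB k).

(* The action of the complex O(-n) -> O on O(-n+k) -> O(k), on cocycles (the
   Cech cup product); for k = 0 it is the product of the complex O(-n) -> O. *)
Definition cup_val (r u : Kxy * Kxy * Kxy) : Kxy * Kxy * Kxy :=
  (r.1.1 * u.2 + r.1.2 * u.1.1, r.1.2 * u.1.2, r.2 * u.2).

Lemma cup_subproof k (r : cocycle 0) (u : cocycle k) :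
  is_cocycle k (cup_val r u).
Proof.
case: r u => [[[a bx] by_] /and4P[/= ha hx hy /eqP E]].
case=> [[[a' bx'] by'] /and4P[/= ha' hx' hy' /eqP E']].
apply/and4P; rewrite /cup_val /=; split.
- apply: rpredD.
    have -> : k - n%:Z = (0 - n%:Z) + k by ring.
    exact: sec_xyM ha (sec_y_xy hy').
  by rewrite -[k - _]add0r; exact: sec_xyM (sec_x_xy hx) ha'.
- by rewrite -[k]add0r; exact: sec_xM hx hx'.
- by rewrite -[k]add0r; exact: sec_yM hy hy'.
by apply/eqP; exact: cup_cocycle_id.
Qed.

Definition cup k (r : cocycle 0) (u : cocycle k) : cocycle k :=
  Cocycle (cup_subproof r u).

Lemma cupBl k (u : cocycle k) : {morph (cup (k := k))^~ u : r r' / r - r'}.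
Proof.
move=> r r'; apply: val_inj; rewrite raddfB /= /cup_val tripleB !raddfB /=.
by rewrite !mulrBl opprD addrACA.
Qed.

Lemma cupBr k (r : cocycle 0) : {morph (@cup k r) : u u' / u - u'}.
Proof.
move=> u u'; apply: val_inj; rewrite raddfB /= /cup_val tripleB !raddfB /=.
by rewrite !mulrBr opprD addrACA.
Qed.

Lemma cup_cobl k (r : cocycle 0) (u : cocycle k) :
  is_coboundary r -> is_coboundary (cup r u).
Proof.
move=> /asboolP[cx [cy [hx hy E]]].
case: u => [[[a bx] by_] hu]; have /and4P[/= ha hbx hby /eqP Eu] := hu.
have Ek : k - n%:Z = (0 - n%:Z) + k by ring.
apply/asboolP; exists (cx * bx), (cy * by_); rewrite Ek; split.
- exact: sec_xM hx hbx.
- exact: sec_yM hy hby.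
by rewrite /= /cup_val E /= !mulrA; congr (_, _, _); exact: cup_cobl_id.
Qed.

Lemma cup_cobr k (r : cocycle 0) (u : cocycle k) :
  is_coboundary u -> is_coboundary (cup r u).
Proof.
move=> /asboolP[cx [cy [hx hy E]]].
case: r => [[[a bx] by_] hr]; have /and4P[/= ha hbx hby /eqP Er] := hr.
apply/asboolP; exists (bx * cx), (by_ * cy); rewrite -[k - _]add0r; split.
- exact: sec_xM hbx hx.
- exact: sec_yM hby hy.
rewrite /= /cup_val E /= !(mulrCA F); congr (_, _, _).
exact: cup_cobr_id.
Qed.

Lemma one_is_cocycle : is_cocycle 0 (0, 1, 1).
Proof.
have h1 : (1 : {mpoly int[2]}) \is 0.-homog by exact: dhomog1.
apply/and4P; split; rewrite /= ?rpred0 ?subrr ?mulr0 //.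
- by rewrite -tofrac1; exact: sections_poly.
- by rewrite -tofrac1; exact: sections_poly.
Qed.

Definition cocycle_one : cocycle 0 := Cocycle one_is_cocycle.

Lemma cup1 k (u : cocycle k) : cup cocycle_one u = u.
Proof.
apply: val_inj; rewrite /= /cup_val /= mul0r add0r !mul1r.
by case: (cocycle_val u) => [[]].
Qed.

Lemma cupA k (r s : cocycle 0) (u : cocycle k) :
  cup r (cup s u) = cup (cup r s) u.
Proof.
apply: val_inj; rewrite /= /cup_val /= !mulrA; congr (_, _, _).
by rewrite mulrDr mulrDl addrA !mulrA.
Qed.

Lemma cupC (r s : cocycle 0) : cup r s = cup s r.
Proof.
case: r => [[[a bx] by_] hr]; have /and4P[/= _ _ _ /eqP Er] := hr.
case: s => [[[a' bx'] by'] hs]; have /and4P[/= _ _ _ /eqP Es] := hs.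
apply: val_inj; rewrite /= /cup_val /= [by_ * _]mulrC [bx * bx']mulrC.
congr (_, _, _); exact: (cupC_id Er Es).
Qed.

(* By H0actE, the chosen representatives are irrelevant. *)
Definition H0act k (r : H0 0) (u : H0 k) : H0 k :=
  \pi_(H0 k) (cup (repr r) (repr u)).

Lemma H0actE k (r : cocycle 0) (u : cocycle k) :
  H0act (\pi_(H0 0) r) (\pi_(H0 k) u) = \pi_(H0 k) (cup r u).
Proof.
rewrite /H0act; set r' := repr _; set u' := repr _.
have hr : is_coboundary (r' - r) by apply/H0_eqP; rewrite reprK.
have hu : is_coboundary (u' - u) by apply/H0_eqP; rewrite reprK.
apply: (@etrans _ _ (\pi_(H0 k) (cup r u'))); apply/H0_eqP.
  by rewrite -cupBl; exact: cup_cobl.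
by rewrite -cupBr; exact: cup_cobr.
Qed.

Lemma H0actA k (r s : H0 0) (u : H0 k) : H0act r (H0act s u) = H0act (H0act r s) u.
Proof.
have [r' ->] := H0_surj r; have [s' ->] := H0_surj s; have [u' ->] := H0_surj u.
by rewrite !H0actE cupA.
Qed.

Lemma H0actC (r s : H0 0) : H0act r s = H0act s r.
Proof.
have [r' ->] := H0_surj r; have [s' ->] := H0_surj s.
by rewrite !H0actE cupC.
Qed.

Lemma H0act1 k (u : H0 k) : H0act (\pi_(H0 0) cocycle_one) u = u.
Proof. by have [u' ->] := H0_surj u; rewrite H0actE cup1. Qed.

Lemma H0actBr k (r : H0 0) (u v : H0 k) : H0act r (u - v) = H0act r u - H0act r v.
Proof.
have [r' ->] := H0_surj r; have [u' ->] := H0_surj u; have [v' ->] := H0_surj v.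
by rewrite !H0actE -!H0_piB H0actE cupBr.
Qed.

Lemma H0actBl k (r s : H0 0) (u : H0 k) : H0act (r - s) u = H0act r u - H0act s u.
Proof.
have [r' ->] := H0_surj r; have [s' ->] := H0_surj s; have [u' ->] := H0_surj u.
by rewrite !H0actE -!H0_piB H0actE cupBl.
Qed.

Lemma H0actDr k (r : H0 0) : {morph (@H0act k r) : u v / u + v}.
Proof.
move=> u v; have h0 : H0act r (0 : H0 k) = 0 by have := H0actBr r u u; rewrite !subrr.
have hN : H0act r (- v) = - H0act r v by rewrite -[- v]sub0r H0actBr h0 sub0r.
by rewrite -{1}[v]opprK H0actBr hN opprK.
Qed.

Lemma H0actDl k (u : H0 k) : {morph (@H0act k)^~ u : r s / r + s}.
Proof.
move=> r s; have h0 : H0act 0 u = 0 by have := H0actBl r r u; rewrite !subrr.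
have hN : H0act (- s) u = - H0act s u by rewrite -[- s]sub0r H0actBl h0 sub0r.
by rewrite -{1}[s]opprK H0actBl hN opprK.
Qed.

End Cech.

(* The ring R_f; form_module f k is the module I_{f,k} over it. *)
Definition form_ring (n : nat) (f : binary_form n) : Type := H0 f 0.

Section FormRing.
Variables (n : nat) (f : binary_form n).

HB.instance Definition _ := GRing.Zmodule.on (form_ring f).
HB.instance Definition _ :=
  GRing.Zmodule_isComPzRing.Build (form_ring f)
    (@H0actA n f 0) (@H0actC n f) (@H0act1 n f 0)
    (fun r s u => @H0actDl n f 0 u r s).
End FormRing.

Definition form_module (n : nat) (f : binary_form n) (k : int) : Type := H0 f k.

Section FormModule.
Variables (n : nat) (f : binary_form n) (k : int).

HB.instance Definition _ := GRing.Zmodule.on (form_module f k).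
HB.instance Definition _ :=
  GRing.Zmodule_isLmodule.Build (form_ring f) (form_module f k)
    (@H0actA n f k) (@H0act1 n f k) (@H0actDr n f k) (@H0actDl n f k).
End FormModule.

Notation V2 := 'rV[int]_2.
Notation V2dual := 'Hom('rV[int]_2, int^o).

Definition coordV (i : 'I_2) (v : V2) : int^o := v 0 i.

Lemma coordV_linear i : linear (coordV i).
Proof. by move=> a u v; rewrite /coordV !mxE. Qed.

HB.instance Definition _ i :=
  GRing.isLinear.Build int V2 int^o _ (coordV i) (coordV_linear i).

Definition dual_basis (i : 'I_2) : V2dual := linfun (coordV i).

(* The m-th tensor power of V, resp. of V^*: the entry of t at (i_1, ..., i_m)
   is the coefficient of e_{i_1} (x) ... (x) e_{i_m} for the standard basis of V,
   resp. of the dual basis of V^*. *)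
Definition tensor (m : nat) : Type := {ffun m.-tuple 'I_2 -> int}.
HB.instance Definition _ m := GRing.Zmodule.on (tensor m).

Definition ptensor m (v : m.-tuple V2) : tensor m :=
  [ffun w => \prod_(i < m) tnth v i 0 (tnth w i)].

Definition ptensor_dual m (phi : m.-tuple V2dual) : tensor m :=
  [ffun w => \prod_(i < m) tnth phi i (delta_mx 0 (tnth w i))].

Definition word_perm m (s : 'S_m) (w : m.-tuple 'I_2) : m.-tuple 'I_2 :=
  [tuple tnth w (s i) | i < m].

Definition tensor_perm m (s : 'S_m) (t : tensor m) : tensor m :=
  [ffun w => t (word_perm s w)].

Lemma tensor_permB m (s : 'S_m) : zmod_morphism (tensor_perm s).
Proof. by move=> t u; apply/ffunP => w; rewrite !ffunE. Qed.

HB.instance Definition _ m (s : 'S_m) :=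
  GRing.isZmodMorphism.Build (tensor m) (tensor m) (tensor_perm s)
    (tensor_permB s).

Lemma tensor_basisE m (t : tensor m) :
  t = \sum_w ptensor [tuple delta_mx 0 (tnth w i) | i < m] *~ t w.
Proof.
apply/ffunP => w; rewrite sum_ffunE (bigD1 w) //= big1 ?addr0 => [|w' w'w].
  rewrite ffunMzE ffunE big1 ?intz // => i _.
  by rewrite tnth_mktuple mxE !eqxx.
rewrite ffunMzE ffunE.
have [i hi] : exists i, tnth w' i != tnth w i.
  apply/existsP; apply: contraNT w'w; rewrite negb_exists => /forallP h.
  by apply/eqP/eq_from_tnth => i; apply/eqP; rewrite -[_ == _]negbK.
by rewrite (bigD1 i) //= tnth_mktuple mxE eqxx eq_sym (negPf hi) mul0r mul0rz.
Qed.

Lemma tensor_perm_ptensor m (s : 'S_m) (v : m.-tuple V2) :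
  tensor_perm s (ptensor v) = ptensor [tuple tnth v (s^-1%g i) | i < m].
Proof.
apply/ffunP => w; rewrite !ffunE [RHS](reindex_perm s).
by apply: eq_bigr => i _; rewrite !tnth_mktuple permK.
Qed.

(* Sym_m is the submodule sym_tensor m, Sym^m the quotient sym_power m. *)
Definition is_symmetric m : pred (tensor m) :=
  fun t => [forall s : 'S_m, tensor_perm s t == t].

Lemma is_symmetric_zmod m : zmod_closed (@is_symmetric m).
Proof.
split; first by apply/forallP => s; rewrite raddf0.
move=> t u /forallP ht /forallP hu; apply/forallP => s.
by rewrite raddfB /= (eqP (ht s)) (eqP (hu s)).
Qed.

HB.instance Definition _ m :=
  GRing.isZmodClosed.Build (tensor m) (@is_symmetric m) (is_symmetric_zmod m).

Record sym_tensor (m : nat) : Type :=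
  SymTensor { sym_tensor_val :> tensor m; _ : is_symmetric sym_tensor_val }.

HB.instance Definition _ m := [isSub for @sym_tensor_val m].
HB.instance Definition _ m := [Choice of sym_tensor m by <:].
HB.instance Definition _ m := [SubChoice_isSubZmodule of sym_tensor m by <:].

(* The sums below form the subgroup generated by all t - s(t), since t - s(t) is
   additive in t. *)
Definition is_sym_relation m : pred (tensor m) :=
  fun t => `[< exists c : 'S_m -> tensor m, t = \sum_s (c s - tensor_perm s (c s)) >].

Lemma is_sym_relation_zmod m : zmod_closed (@is_sym_relation m).
Proof.
split.
  apply/asboolP; exists (fun=> 0); rewrite big1 // => s _.
  by rewrite raddf0 subrr.
move=> t u /asboolP[c ->] /asboolP[d ->]; apply/asboolP.
exists (fun s => c s - d s); rewrite -sumrB; apply: eq_bigr => s _.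
by rewrite tensor_permB subrACA.
Qed.

HB.instance Definition _ m :=
  GRing.isZmodClosed.Build (tensor m) (@is_sym_relation m)
    (is_sym_relation_zmod m).

Definition sym_relations (m : nat) : zmodClosed (tensor m) :=
  GRing.ZmodClosed.clone (tensor m) (@is_sym_relation m) _.

Definition sym_power (m : nat) : Type := Quotient.quot (sym_relations m).
HB.instance Definition _ m := GRing.Zmodule.on (sym_power m).
HB.instance Definition _ m := EqQuotient.on (sym_power m).

(* Keeps the first of the m+1 factors V^* and pairs the last m factors V^* with
   the m factors V; see contract_ptensor for its value on pure tensors. *)
Definition contract m (t : tensor m.+1) (u : tensor m) : V2dual :=
  \sum_i (\sum_w t (cons_tuple i w) * u w) *: dual_basis i.

(* By natural_mapE, the chosen representative is irrelevant. *)
Definition natural_map m (t : sym_tensor m.+1) (k : sym_power m) : V2dual :=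
  contract t (repr k).

Lemma contractB m (t : tensor m.+1) : {morph contract t : u v / u - v}.
Proof.
move=> u v; rewrite /contract -sumrB; apply: eq_bigr => i _.
rewrite -scalerBl -sumrB; congr (_ *: _); apply: eq_bigr => w _.
by rewrite !ffunE mulrBr.
Qed.

Lemma word_perm_bij m (s : 'S_m) : bijective (word_perm s).
Proof.
exists (word_perm s^-1); move=> w; apply: eq_from_tnth => i;
by rewrite !tnth_mktuple ?permKV ?permK.
Qed.

Lemma tensor_perm_cons m (s : 'S_m) (t : tensor m.+1) i w :
  is_symmetric t -> t (cons_tuple i (word_perm s w)) = t (cons_tuple i w).
Proof.
move=> /forallP/(_ (lift_perm ord0 ord0 s))/eqP/ffunP/(_ (cons_tuple i w)).
rewrite ffunE => <-; congr (t _); apply: eq_from_tnth => j.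
rewrite tnth_mktuple; case: (unliftP ord0 j) => [j' ->|->].
  by rewrite lift_perm_lift !tnthS tnth_mktuple.
by rewrite lift_perm_id !tnth0.
Qed.

Lemma contract_perm m (s : 'S_m) (t : tensor m.+1) (u : tensor m) :
  is_symmetric t -> contract t (tensor_perm s u) = contract t u.
Proof.
move=> ht; apply: eq_bigr => i _; congr (_ *: _).
rewrite [RHS](reindex (word_perm s)) /=; last exact: onW_bij (word_perm_bij s).
by apply: eq_bigr => w _; rewrite ffunE tensor_perm_cons.
Qed.

Lemma natural_mapE m (t : sym_tensor m.+1) (u : tensor m) :
  natural_map t (\pi_(sym_power m) u) = contract t u.
Proof.
rewrite /natural_map; set v := repr _.
have /asboolP[c Ec] : is_sym_relation (v - u).
  suff /eqP : \pi_(sym_power m) v = \pi_(sym_power m) u.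
    by rewrite -(Quotient.idealrBE (sym_relations m)).
  by rewrite reprK.
have ht : is_symmetric t by case: t.
have h0 : contract t 0 = 0 by have := contractB t 0 0; rewrite !subrr.
apply/eqP; rewrite -subr_eq0 -contractB Ec; apply/eqP.
elim/big_rec: _ => // s x _ IH.
have hN : contract t (- x) = 0 by rewrite -[- x]sub0r contractB IH h0 subrr.
by rewrite -{1}[x]opprK contractB hN contractB contract_perm ?subrr.
Qed.

Lemma dual_expand (phi : V2dual) (v : V2) :
  phi v = \sum_i phi (delta_mx 0 i) * v 0 i.
Proof.
rewrite {1}[v]row_sum_delta linear_sum; apply: eq_bigr => i _.
by rewrite linearZ mulrC.
Qed.

Lemma dual_basisE i (v : V2) : dual_basis i v = v 0 i.
Proof. by rewrite lfunE. Qed.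

Lemma sum_words m (G : 'I_m -> 'I_2 -> int) :
  \sum_(w : m.-tuple 'I_2) \prod_(j < m) G j (tnth w j) =
  \prod_(j < m) \sum_a G j a.
Proof.
rewrite bigA_distr_bigA /=.
rewrite (reindex (fun g : {ffun 'I_m -> 'I_2} => [tuple g j | j < m])) /=.
  by apply: eq_bigr => g _; apply: eq_bigr => j _; rewrite tnth_mktuple.
exists (fun w : m.-tuple 'I_2 => [ffun j => tnth w j]).
  by move=> g _; apply/ffunP => j; rewrite ffunE tnth_mktuple.
by move=> w _; apply: eq_from_tnth => j; rewrite tnth_mktuple ffunE.
Qed.

Lemma contract_ptensor m (phi : m.+1.-tuple V2dual) (v : m.-tuple V2) :
  contract (ptensor_dual phi) (ptensor v) =
  (\prod_(i < m) tnth phi (lift ord0 i) (tnth v i)) *: tnth phi ord0.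
Proof.
apply/lfunP => x; rewrite sum_lfunE scale_lfunE (dual_expand (tnth phi ord0) x).
rewrite scaler_sumr; apply: eq_bigr => i _.
rewrite scale_lfunE dual_basisE.
under eq_bigr => w _.
  rewrite !ffunE big_ord_recl !tnth0 -mulrA -big_split /=.
  under eq_bigr => j _ do rewrite tnthS.
  over.
rewrite -mulr_sumr.
rewrite (sum_words (fun j a => tnth phi (lift ord0 j) (delta_mx 0 a) * tnth v j 0 a)).
under [in RHS]eq_bigr => j _ do rewrite dual_expand.
by rewrite /GRing.scale /= mulrCA mulrA.
Qed.

Section ModZ.
Variable R : comPzRingType.

Definition is_integer : pred R := fun r => `[< exists z : int, r = z%:~R >].

Lemma is_integer_zmod : zmod_closed is_integer.
Proof.
split; first by apply/asboolP; exists 0.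
move=> r s /asboolP[y ->] /asboolP[z ->].
by apply/asboolP; exists (y - z); rewrite intrB.
Qed.

HB.instance Definition _ := GRing.isZmodClosed.Build R is_integer is_integer_zmod.

Definition integers : zmodClosed R := GRing.ZmodClosed.clone R is_integer _.

Definition mod_Z : Type := Quotient.quot integers.
HB.instance Definition _ := GRing.Zmodule.on mod_Z.
HB.instance Definition _ := EqQuotient.on mod_Z.
End ModZ.

Definition is_Zbasis (M : zmodType) (J : finType) (b : J -> M) : Prop :=
  forall x : M, exists! c : {ffun J -> int}, x = \sum_j b j *~ c j.

Definition has_coef (M : zmodType) (J : finType) (b : J -> M) (x : M) (j : J)
    (z : int) : Prop :=
  exists2 c : {ffun J -> int}, x = \sum_j b j *~ c j & c j = z.

Definition sum_family (M J K : Type) (a : J -> M) (b : K -> M) (s : J + K) : M :=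
  match s with inl j => a j | inr k => b k end.

Definition associated_to_form (n : nat) (R : comPzRingType) (I : lmodType R) :
    Prop :=
  exists (f : binary_form n) (phi : {rmorphism R -> form_ring f})
    (psi : {additive I -> form_module f (n%:Z - 3)}),
  [/\ bijective phi, bijective psi
    & forall (r : R) (v : I), psi (r *: v) = phi r *: psi v].

(* Here n - 2 is written (n - 3).+1, for natural_map to typecheck; this is only
   meant for n >= 3. *)
Definition symmetric_structure (n : nat) (R : comPzRingType) (I : lmodType R) :
    Prop :=
  exists (phi : {additive mod_Z R -> sym_tensor (n - 3).+1})
    (iota : {additive sym_power (n - 3) -> I}) (q : {additive I -> V2dual}),
  [/\ bijective phi, injective iota,
      forall x : I, q x = 0 <-> exists k, x = iota k,
      forall l : V2dual, exists x : I, q x = l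
    & forall (r : R) (k : sym_power (n - 3)),
        q (r *: iota k) = natural_map (phi (\pi_(mod_Z R) r)) k].

(* alpha and beta are indexed from 0 instead of 1. *)
Definition normalized_bases (n : nat) (R : comPzRingType) (I : lmodType R) :
    Prop :=
  exists (zeta : 'I_n -> R) (alpha : 'I_2 -> I) (beta : 'I_(n - 2) -> I),
  [/\ is_Zbasis zeta,
      forall j : 'I_n, j = 0%N :> nat -> zeta j = 1,
      is_Zbasis (sum_family alpha beta)
    & forall (i : 'I_2) (j : 'I_n) (k : 'I_(n - 2)),
        has_coef (sum_family alpha beta) (zeta j *: beta k) (inl i)
          (if (i.+1 + j + k.+1 == n.+1)%N then 1 else 0)].

(* Main.v *)
Require Import Defs.
From HB Require Import structures.
From mathcomp Require Import all_boot all_order all_fingroup all_algebra.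
From mathcomp Require Import fraction generic_quotient ring_quotient boolp.
From mathcomp Require Import mpoly.
From mathcomp Require Import ring zify.

Set Implicit Arguments.
Unset Strict Implicit.
Unset Printing Implicit Defensive.

(** Write zeta_0 = 1, ..., zeta_(n-1) and alpha_a, beta_k for bases as in (3),
    q_0, q_1 for the alpha-coordinates on I, and put zeta_n = 0. For every
    i < n the functional w |-> q_0 (zeta_(i+1) w) - q_1 (zeta_i w) vanishes on
    the beta_k, so it equals u_i q_0 + v_i q_1 for some integers u_i, v_i.
    Translating zeta_(i+1) by - u_i makes the u_i vanish for i < n - 1, and the
    remaining integers v_0 + 1, v_1, ..., v_(n-1), u_(n-1) are the coefficients
    of a form f: with zeta_0 replaced by 0 and zeta_n by - f_n one gets
    q_0 (zeta_(i+1) w) = q_1 (zeta_i w) + f_i q_1 (w) for all i < n. Applied to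
    w = zeta_j beta_k this is a recurrence on the structure constants of R
    modulo Z, which together with their symmetry determines them; associativity
    then gives the ring R, and, once alpha_a is chosen to be
    zeta_(n-1-a) beta_0, also the module I. In the Cech model of f, the cocycle
    zeta_i has the overlap component x^(i-n) y^(-i), and the same identity
    holds because y zeta_(i+1) - x zeta_i is the global section f_i x of O(1).
    Hence (1) and (3) are equivalent. For (2), symmetric tensors and elements
    of Sym^m V are functions of the number of indices 1 in a word. *)

Import Order.TTheory GRing.Theory Num.Theory.
Local Open Scope ring_scope.
Local Open Scope quotient_scope.

Local Notation "p %:F" := (tofrac p).

(** * Bases and coordinates *)

Section Coordinates.
Variables (M : zmodType) (J : finType) (b : J -> M).
Hypothesis b_basis : is_Zbasis b.

Definition zcoord_fun (j : J) (x : M) : int := sval (cid (b_basis x)) j.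

Lemma zcoord_sum x : x = \sum_j b j *~ zcoord_fun j x.
Proof. by have [] := svalP (cid (b_basis x)). Qed.

Lemma zcoord_uniq (c : J -> int) x j : x = \sum_j b j *~ c j -> zcoord_fun j x = c j.
Proof.
move=> E; have [_ uniq_d] := svalP (cid (b_basis x)).
rewrite /zcoord_fun; suff -> : sval (cid (b_basis x)) = [ffun j => c j] by rewrite ffunE.
by apply: uniq_d; rewrite E; apply: eq_bigr => i _; rewrite ffunE.
Qed.

Lemma zcoord_zmod_morphism j : zmod_morphism (zcoord_fun j).
Proof.
move=> x y; apply: (zcoord_uniq (c := fun j => zcoord_fun j x - zcoord_fun j y)).
rewrite [x in LHS]zcoord_sum [y in LHS]zcoord_sum -sumrB.
by apply: eq_bigr => i _; rewrite mulrzBr.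
Qed.

Definition zcoord j : {additive M -> int} :=
  HB.pack_for {additive M -> int} (zcoord_fun j)
    (GRing.isZmodMorphism.Build M int (zcoord_fun j) (zcoord_zmod_morphism j)).

Lemma zcoord_basis j k : zcoord j (b k) = (j == k).
Proof.
apply: (zcoord_uniq (c := fun j => Posz (j == k))).
rewrite (bigD1 k) //= eqxx big1 ?addr0 // => i /negPf ->.
by rewrite mulr0z.
Qed.

End Coordinates.

Lemma is_ZbasisP (M : zmodType) (J : finType) (b : J -> M)
    (c : J -> {additive M -> int}) :
    (forall x, x = \sum_j b j *~ c j x) ->
    (forall j k, c j (b k) = (j == k)) ->
  is_Zbasis b.
Proof.
move=> sum_c c_b x; exists [ffun j => c j x]; split.
  by rewrite {1}[x]sum_c; apply: eq_bigr => j _; rewrite ffunE.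
move=> d -> ; apply/ffunP => j; rewrite ffunE raddf_sum (bigD1 j) //=.
rewrite raddfMz c_b eqxx intz big1 ?addr0 // => i /negPf ij.
by rewrite raddfMz c_b eq_sym ij mul0rz.
Qed.

Lemma is_Zbasis_free (M : zmodType) (J : finType) (b : J -> M) :
    (forall x, exists c : J -> int, x = \sum_j b j *~ c j) ->
    (forall c : J -> int, \sum_j b j *~ c j = 0 -> forall j, c j = 0) ->
  is_Zbasis b.
Proof.
move=> span_b free_b x; have [c Ex] := span_b x; exists [ffun j => c j]; split.
  by rewrite Ex; apply: eq_bigr => j _; rewrite ffunE.
move=> d Ed; apply/ffunP => j; rewrite ffunE; apply/eqP; rewrite -subr_eq0; apply/eqP.
apply: (free_b (fun j => c j - d j)).
under eq_bigr => i _ do rewrite mulrzBr.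
by rewrite sumrB -Ex -Ed subrr.
Qed.

Lemma is_Zbasis_reindex (M : zmodType) (J K : finType) (b : J -> M) (h : K -> J) :
  bijective h -> is_Zbasis b -> is_Zbasis (b \o h).
Proof.
move=> h_bij bB; have h_inj := bij_inj h_bij.
apply: (is_ZbasisP (c := fun k => zcoord bB (h k))) => [x|j k].
  by rewrite {1}[x](zcoord_sum bB) (reindex h) //; exact: onW_bij.
by rewrite zcoord_basis (inj_eq h_inj).
Qed.

(** Injectivity suffices: the coordinates of [g x] in [b'] are also coordinates of [x], because both
    sides have the same image under [g]. *)
Lemma is_Zbasis_pullback (M N : zmodType) (J : finType) (g : {additive M -> N})
    (b : J -> M) (b' : J -> N) :
  injective g -> (forall j, g (b j) = b' j) -> is_Zbasis b' -> is_Zbasis b.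
Proof.
move=> g_inj gb b'B.
have gsum (c : J -> int) : g (\sum_j b j *~ c j) = \sum_j b' j *~ c j.
  by rewrite raddf_sum; apply: eq_bigr => j _; rewrite raddfMz gb.
move=> x; have [c [Ec uniq_c]] := b'B (g x); exists c; split.
  by apply: g_inj; rewrite gsum.
by move=> d Ed; apply: uniq_c; rewrite Ed gsum.
Qed.

(* The data of normalized_bases for n = m + 3, with families indexed by nat
   from 0 and with the coordinate functions on the two bases. *)
Record normdata (m : nat) (R : comPzRingType) (I : lmodType R) := NormData {
  zet : nat -> R;
  alp : nat -> I;
  bet : nat -> I;
  rco : nat -> {additive R -> int};
  qco : nat -> {additive I -> int};
  bco : nat -> {additive I -> int};
  rco_sum : forall r, r = \sum_(j < m.+3) zet j *~ rco j r;
  rco_zet : forall j k, (j < m.+3)%N -> (k < m.+3)%N -> rco k (zet j) = (j == k);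
  ico_sum : forall x, x = \sum_(a < 2) alp a *~ qco a x
                        + \sum_(k < m.+1) bet k *~ bco k x;
  qco_alp : forall a b, (a < 2)%N -> (b < 2)%N -> qco a (alp b) = (a == b);
  qco_bet : forall a k, (a < 2)%N -> (k < m.+1)%N -> qco a (bet k) = 0;
  bco_alp : forall k a, (k < m.+1)%N -> (a < 2)%N -> bco k (alp a) = 0;
  bco_bet : forall k l, (k < m.+1)%N -> (l < m.+1)%N -> bco k (bet l) = (k == l);
  zet0 : zet 0%N = 1;
  qco_act : forall a j k, (a < 2)%N -> (j < m.+3)%N -> (k < m.+1)%N ->
    qco a (zet j *: bet k) = (a + j + k == m.+2)%N }.

Lemma normdata_of_bases m (R : comPzRingType) (I : lmodType R)
    (z : 'I_m.+3 -> R) (a : 'I_2 -> I) (b : 'I_m.+1 -> I) :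
    is_Zbasis z -> z ord0 = 1 -> is_Zbasis (sum_family a b) ->
    (forall i j k, has_coef (sum_family a b) (z j *: b k) (inl i)
      (if (i.+1 + j + k.+1 == m.+4)%N then 1 else 0)) ->
  exists D : normdata m I, [/\ forall j : 'I_m.+3, zet D j = z j,
    forall i : 'I_2, alp D i = a i & forall k : 'I_m.+1, bet D k = b k].
Proof.
move=> zB z0 abQ act.
have nat_nat p q i : (q < p.+1)%N -> (i < p.+1)%N ->
    (inord q == inord i :> 'I_p.+1) = (q == i).
  by move=> qp ip; rewrite -val_eqE /= !inordK.
(* [inord] extends the families from ordinals to all naturals. Values out of range are junk, which
   is why the fields of [normdata] carry range hypotheses. *)
unshelve eexists; first apply: (@NormData m R I (fun j => z (inord j)) (fun i => a (inord i))
  (fun k => b (inord k)) (fun j => zcoord zB (inord j))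
  (fun i => zcoord abQ (inl (inord i))) (fun k => zcoord abQ (inr (inord k)))).
- by move=> r; rewrite {1}[r](zcoord_sum zB); apply: eq_bigr => j _; rewrite inord_val.
- by move=> j k hj hk; rewrite zcoord_basis eq_sym nat_nat.
- move=> x; rewrite {1}[x](zcoord_sum abQ) big_sumType /=.
  by congr (_ + _); apply: eq_bigr => j _; rewrite inord_val.
- move=> i j hi hj; rewrite (zcoord_basis abQ (inl _) (inl _)).
  by rewrite -(nat_nat 1%N).
- by move=> i j hi hj; rewrite (zcoord_basis abQ (inl _) (inr _)).
- by move=> i j hi hj; rewrite (zcoord_basis abQ (inr _) (inl _)).
- move=> i j hi hj; rewrite (zcoord_basis abQ (inr _) (inr _)).
  by rewrite -(nat_nat m).
- by rewrite -z0; congr z; apply: val_inj; rewrite /= inordK.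
- move=> i j k hi hj hk.
  have [c E ci] := act (inord i) (inord j) (inord k).
  transitivity (c (inl (inord i))); first exact: (zcoord_uniq abQ).
  rewrite ci !inordK //.
  (* Counting [alpha] and [beta] from 0 instead of 1 lowers the required sum n + 1 = m + 4 by
     two. *)
  have -> : (i.+1 + j + k.+1 == m.+4)%N = (i + j + k == m.+2)%N by lia.
  by case: eqP.
by split=> j /=; rewrite inord_val.
Qed.

Lemma bases_of_normdata m (R : comPzRingType) (I : lmodType R) :
  normdata m I -> normalized_bases m.+3 I.
Proof.
move=> D.
pose a (i : 'I_2) := alp D i; pose b (k : 'I_m.+1) := bet D k.
pose ab := sum_family a b.
pose c (s : 'I_2 + 'I_m.+1) : {additive I -> int} :=
  match s with inl i => qco D i | inr k => bco D k end.
have sum_ab x : x = \sum_j ab j *~ c j x.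
  by rewrite big_sumType /=; exact: ico_sum.
exists (fun j => zet D j), a, b; split.
- apply: (@is_ZbasisP _ _ _ (fun j : 'I_m.+3 => rco D j)); first exact: rco_sum.
  by move=> j k; rewrite rco_zet // eq_sym.
- by move=> j ->; exact: zet0.
- apply: (@is_ZbasisP _ _ _ c sum_ab).
  move=> [i|k] [j|l]; rewrite /= ?qco_alp ?qco_bet ?bco_alp ?bco_bet //.
move=> i j k; exists [ffun s => c s (zet D j *: bet D k)].
  by rewrite {1}[LHS]sum_ab; apply: eq_bigr => s _; rewrite ffunE.
rewrite ffunE /= qco_act //.
have -> : (i.+1 + j + k.+1 == m.+4)%N = (i + j + k == m.+2)%N by lia.
by case: eqP.
Qed.

(** * Normalized structures *)

Lemma sum_delta n k (F : nat -> int) : (k < n)%N ->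
  \sum_(j < n) (k == j)%:Z * F j = F k.
Proof.
move=> kn; rewrite (bigD1 (Ordinal kn)) //= eqxx mul1r big1 ?addr0 // => j.
by rewrite -val_eqE /= eq_sym => /negPf ->; rewrite mul0r.
Qed.

Section Normdata.
Variables (m : nat) (R : comPzRingType) (I : lmodType R) (D : normdata m I).
Local Notation z := (zet D).
Local Notation al := (alp D).
Local Notation be := (bet D).
Local Notation rc := (rco D).
Local Notation qc := (qco D).
Local Notation bc := (bco D).

Lemma rco_int k (c : int) : (0 < k < m.+3)%N -> rc k c%:~R = 0.
Proof.
case/andP=> k0 kn; rewrite raddfMz -(zet0 D) rco_zet //.
by rewrite ltn_eqF // mul0rz.
Qed.

(** Only the [z j] with [a + j + k = m.+2] contributes. As [a] and [k] vary, the index runs through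
    all of 1, ..., m + 2, so these values determine [r] modulo the integers. *)
Lemma qco_scale_bet a r k : (a < 2)%N -> (k < m.+1)%N ->
  qc a (r *: be k) = rc (m.+2 - a - k)%N r.
Proof.
move=> ha hk; rewrite {1}[r](rco_sum D) scaler_suml raddf_sum.
rewrite -(@sum_delta m.+3 (m.+2 - a - k) (fun j => rc j r)); last by lia.
apply: eq_bigr => j _; rewrite -scalerMzl raddfMz qco_act //.
have -> : (a + j + k == m.+2)%N = (m.+2 - a - k == j)%N by have := ltn_ord j; lia.
by rewrite -mulrzr intz.
Qed.

Lemma icoP (x y : I) : (forall a, (a < 2)%N -> qc a x = qc a y) ->
  (forall k, (k < m.+1)%N -> bc k x = bc k y) -> x = y.
Proof.
move=> hq hb; rewrite [x](ico_sum D) [y](ico_sum D); congr (_ + _).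
  by apply: eq_bigr => a _; rewrite hq.
by apply: eq_bigr => k _; rewrite hb.
Qed.

Lemma rcoP (r s : R) : (forall j, (j < m.+3)%N -> rc j r = rc j s) -> r = s.
Proof.
move=> h; rewrite [r](rco_sum D) [s](rco_sum D).
by apply: eq_bigr => j _; rewrite h.
Qed.

(* In the model with theta = x/y, this is f_0 theta^i + ... + f_(i-1) theta,
   which vanishes for i = 0 and is the constant - f_n for i = n. *)
Definition ext_zeta (f : nat -> int) i : R :=
  if i == 0%N then 0 else if i == m.+3 then (- f m.+3)%:~R else z i.

(** The first clause is the recurrence that the form imposes. The second fixes [al], which the
    functionals [qc] determine only up to combinations of the [be k]. *)
Definition form_data (f : nat -> int) : Prop :=
  (forall i w, (i < m.+3)%N ->
    qc 0 (ext_zeta f i.+1 *: w) = qc 1 (ext_zeta f i *: w) + f i * qc 1 w) /\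
  (forall b, (b < 2)%N -> al b = z (m.+2 - b)%N *: be 0).

Section FormData.
Variable f : nat -> int.
Hypothesis Df : form_data f.
Local Notation zh := (ext_zeta f).

Lemma ext_zetaE i : (0 < i < m.+3)%N -> zh i = z i.
Proof. by case/andP=> i0 im; rewrite /ext_zeta gtn_eqF // ltn_eqF. Qed.

Lemma ext_zeta0 : zh 0 = 0. Proof. by []. Qed.

Lemma ext_zetan : zh m.+3 = (- f m.+3)%:~R.
Proof. by rewrite /ext_zeta eqxx. Qed.

(** The two exceptional values, at 0 and at n, are integers and so have no coordinate of positive
    index. *)
Lemma rco_ext_zeta j k : (j <= m.+3)%N -> (0 < k < m.+3)%N ->
  rc k (zh j) = (j == k).
Proof.
move=> hj hk; have [->|j0] := posnP j.
  by rewrite ext_zeta0 raddf0; lia.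
have [->|jn] := eqVneq j m.+3.
  by rewrite ext_zetan rco_int //; lia.
rewrite ext_zetaE ?rco_zet //; lia.
Qed.

(** This is the recurrence of [form_data] at [w = zh j *: be (m.+1 - k)]: by [qco_scale_bet], [qc 0]
    reads the coordinate of index [k.+1] and [qc 1] that of index [k]. *)
Lemma rco_ext_zetaM i j k : (i < m.+3)%N -> (j <= m.+3)%N -> (0 < k < m.+2)%N ->
  rc k.+1 (zh i.+1 * zh j) = rc k (zh i * zh j) + f i * (j == k).
Proof.
move=> hi hj hk.
have := Df.1 i (zh j *: be (m.+1 - k)%N) hi.
rewrite !scalerA !qco_scale_bet //; try lia.
have -> : (m.+2 - 0 - (m.+1 - k) = k.+1)%N by lia.
have -> : (m.+2 - 1 - (m.+1 - k) = k)%N by lia.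
rewrite rco_ext_zeta //; lia.
Qed.

End FormData.
End Normdata.

(* The indices i, j, k are those of the structure constants of the ring; the
   recurrence moves (i, k) diagonally until i reaches 0 or n, and the diagonal
   i = k is left by exchanging i and j. *)
Lemma diagonal_rec_eq0 (m : nat) (e : nat -> nat -> nat -> int) :
    (forall i j k, (i < m.+3)%N -> (j <= m.+3)%N -> (0 < k < m.+2)%N ->
       e i.+1 j k.+1 = e i j k) ->
    (forall i j k, e i j k = e j i k) ->
    (forall j k, e 0%N j k = 0) ->
    (forall j k, (j <= m.+3)%N -> (0 < k < m.+3)%N -> e m.+3 j k = 0) ->
  forall i j k, (i <= m.+3)%N -> (j <= m.+3)%N -> (0 < k < m.+3)%N -> e i j k = 0.
Proof.
move=> erec esym e0 en.
(* For [i < k] the recurrence descends to [i = 0]; for [i > k], treated next, it ascends to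
   [i = m.+3]. *)
have elt i j k : (i < k)%N -> (j <= m.+3)%N -> (k < m.+3)%N -> e i j k = 0.
  elim: i k => [|i IH] [|k] // ik hj hk.
  by rewrite erec ?IH //; lia.
have egt i j k : (i <= m.+3)%N -> (k < i)%N -> (j <= m.+3)%N -> (0 < k < m.+3)%N ->
    e i j k = 0.
  move=> hi; move Ed: (m.+3 - i)%N => d; elim: d i k Ed hi => [|d IH] i k Ed hi ki hj hk.
    have -> : i = m.+3 by lia.
    exact: en.
  by rewrite -erec ?IH //; lia.
have eij i j k : i != k -> (i <= m.+3)%N -> (j <= m.+3)%N -> (0 < k < m.+3)%N -> e i j k = 0.
  move=> ik hi hj hk; have [ltik|ltki|eqik] := ltngtP i k; last by rewrite eqik eqxx in ik.
    by rewrite elt //; lia.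
  by rewrite egt.
move=> i j k hi hj hk; have [->|] := eqVneq i k; last by move=> ik; exact: eij.
have [->|jk] := eqVneq j k; last first.
  by rewrite esym eij //; lia.
(* Here all three indices equal [k]. One diagonal step moves the first and third but not the second,
   so after an exchange the first differs from the third. The step goes up, except at the top value
   [m.+2]. *)
have [kn|kn] := ltnP k m.+2.
  by rewrite -erec ?(esym k.+1) ?eij //; lia.
have -> : k = m.+2 by lia.
by rewrite erec ?(esym m.+1) ?eij //; lia.
Qed.

(** * Uniqueness *)

Section StructureConstants.
Variables (m : nat) (R : comPzRingType) (I : lmodType R) (D : normdata m I).
Local Notation z := (zet D).
Local Notation al := (alp D).
Local Notation be := (bet D).
Local Notation rc := (rco D).
Local Notation qc := (qco D).
Local Notation bc := (bco D).

Lemma rcoMl l r s : rc l (r * s) = \sum_(k < m.+3) rc k r * rc l (z k * s).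
Proof.
rewrite {1}[r](rco_sum D) mulr_suml raddf_sum; apply: eq_bigr => k _.
by rewrite mulrzAl raddfMz -mulrzr intz mulrC.
Qed.

Lemma rcoM l r s :
  rc l (r * s) = \sum_(k < m.+3) \sum_(j < m.+3) rc k r * (rc j s * rc l (z k * z j)).
Proof.
rewrite rcoMl; apply: eq_bigr => k _; rewrite [z k * s]mulrC rcoMl mulr_sumr.
by apply: eq_bigr => j _; rewrite [z j * _]mulrC.
Qed.

(** Compare the [z l]-coordinates of [(z j * z l) * z i] and [(z i * z j) * z l]. The constant term
    of [z i * z j] enters the second with factor 1, while that of [z j * z l] drops out of the first
    because [l != i]. Only structure constants with positive last index remain. *)
Lemma rco0_mul i j l : (i < m.+3)%N -> (j < m.+3)%N -> (0 < l < m.+3)%N -> l != i ->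
  rc 0 (z i * z j) =
    \sum_(k < m.+2) rc k.+1 (z j * z l) * rc l (z i * z k.+1)
    - \sum_(k < m.+2) rc k.+1 (z i * z j) * rc l (z k.+1 * z l).
Proof.
move=> hi hj hl li; have /andP[l0 ln] := hl.
have : rc l (z j * z l * z i) = rc l (z i * z j * z l).
  by congr (rc l _); rewrite mulrC mulrA.
rewrite (rcoMl l (z j * z l)) (rcoMl l (z i * z j)) !(big_ord_recl m.+2) /= zet0.
rewrite !mul1r !rco_zet // eqxx eq_sym (negPf li) mulr0 add0r mulr1 => E.
apply/eqP; rewrite eq_sym subr_eq; apply/eqP; apply: etrans E.
by apply: eq_bigr => k _; rewrite [z i * _]mulrC.
Qed.

(** Multiplication by [z (m.+2 - p)] followed by [qc 0] is 1 on [be p] and 0 on the other [be k];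
    the contribution of the [al b] is subtracted. Thus [bc] is expressed through [qc] and the
    action. *)
Lemma bco_qco p x : (p < m.+1)%N ->
  bc p x = qc 0 (z (m.+2 - p)%N *: x)
           - \sum_(b < 2) qc b x * qc 0 (z (m.+2 - p)%N *: al b).
Proof.
move=> hp; apply/eqP; rewrite eq_sym subr_eq; apply/eqP.
rewrite {1}[x](ico_sum D) scalerDr raddfD addrC !scaler_sumr !raddf_sum /=.
congr (_ + _); last first.
  by apply: eq_bigr => b _; rewrite -scalerMzr raddfMz -mulrzr intz mulrC.
rewrite -(@sum_delta m.+1 p (fun p => bc p x) hp).
apply: eq_bigr => k _; rewrite -scalerMzr raddfMz qco_act //; last by lia.
have -> : (0 + (m.+2 - p) + k == m.+2)%N = (p == k)%N by have := ltn_ord k; lia.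
by rewrite -mulrzr intz.
Qed.

Lemma eq_on_bases (V : zmodType) (g h : I -> V) :
    zmod_morphism g -> zmod_morphism h ->
    (forall a, (a < 2)%N -> g (al a) = h (al a)) ->
    (forall k, (k < m.+1)%N -> g (be k) = h (be k)) ->
  g =1 h.
Proof.
move=> gB hB eq_al eq_be x.
pose gA := HB.pack_for {additive I -> V} g (GRing.isZmodMorphism.Build I V g gB).
pose hA := HB.pack_for {additive I -> V} h (GRing.isZmodMorphism.Build I V h hB).
change (gA x = hA x); rewrite [x](ico_sum D) !raddfD !raddf_sum.
by congr (_ + _); apply: eq_bigr => i _; rewrite !raddfMz /= ?eq_al ?eq_be.
Qed.

End StructureConstants.

Section Transport.
Variables (m : nat) (R R' : comPzRingType) (I : lmodType R) (I' : lmodType R').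
Variables (D : normdata m I) (D' : normdata m I').

Definition ring_transport (r : R) : R' := \sum_(j < m.+3) zet D' j *~ rco D j r.

Definition module_transport (x : I) : I' :=
  \sum_(a < 2) alp D' a *~ qco D a x + \sum_(k < m.+1) bet D' k *~ bco D k x.

Lemma ring_transport_zmod_morphism : zmod_morphism ring_transport.
Proof.
by move=> r s; rewrite -sumrB; apply: eq_bigr => j _; rewrite raddfB mulrzBr.
Qed.

Lemma module_transport_zmod_morphism : zmod_morphism module_transport.
Proof.
move=> x y; rewrite opprD addrACA -!sumrB; congr (_ + _);
by apply: eq_bigr => j _; rewrite raddfB mulrzBr.
Qed.

Lemma rco_transport j r : (j < m.+3)%N -> rco D' j (ring_transport r) = rco D j r.
Proof.
move=> hj; rewrite raddf_sum -(@sum_delta m.+3 j (fun j => rco D j r) hj).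
apply: eq_bigr => k _; rewrite raddfMz rco_zet // -mulrzr intz.
by rewrite eq_sym.
Qed.

Lemma qco_transport a x : (a < 2)%N -> qco D' a (module_transport x) = qco D a x.
Proof.
move=> ha; rewrite raddfD !raddf_sum /= [X in _ + X]big1 ?addr0 => [|k _]; last first.
  by rewrite raddfMz qco_bet // mul0rz.
rewrite -(@sum_delta 2 a (fun a => qco D a x) ha).
by apply: eq_bigr => b _; rewrite raddfMz qco_alp // -mulrzr intz.
Qed.

Lemma bco_transport k x : (k < m.+1)%N -> bco D' k (module_transport x) = bco D k x.
Proof.
move=> hk; rewrite raddfD !raddf_sum /= big1 ?add0r => [|a _]; last first.
  by rewrite raddfMz bco_alp // mul0rz.
rewrite -(@sum_delta m.+1 k (fun k => bco D k x) hk).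
by apply: eq_bigr => b _; rewrite raddfMz bco_bet // -mulrzr intz.
Qed.

Lemma ring_transport_zet j : (j < m.+3)%N -> ring_transport (zet D j) = zet D' j.
Proof.
move=> hj; apply: (rcoP (D := D')) => k hk.
by rewrite rco_transport // !rco_zet.
Qed.

Lemma module_transport_bet k : (k < m.+1)%N -> module_transport (bet D k) = bet D' k.
Proof.
move=> hk; apply: (icoP (D := D')) => [a ha|l hl].
  by rewrite qco_transport // !qco_bet.
by rewrite bco_transport // !bco_bet.
Qed.

Lemma module_transport_alp a : (a < 2)%N -> module_transport (alp D a) = alp D' a.
Proof.
move=> ha; apply: (icoP (D := D')) => [b hb|l hl].
  by rewrite qco_transport // !qco_alp.
by rewrite bco_transport // !bco_alp.
Qed.

End Transport.

Lemma ring_transportK m (R R' : comPzRingType) (I : lmodType R) (I' : lmodType R')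
    (D : normdata m I) (D' : normdata m I') :
  cancel (ring_transport D D') (ring_transport D' D).
Proof. by move=> r; apply: (rcoP (D := D)) => j hj; rewrite !rco_transport. Qed.

Lemma module_transportK m (R R' : comPzRingType) (I : lmodType R) (I' : lmodType R')
    (D : normdata m I) (D' : normdata m I') :
  cancel (module_transport D D') (module_transport D' D).
Proof.
move=> x; apply: (icoP (D := D)) => [a ha|k hk].
  by rewrite !qco_transport.
by rewrite !bco_transport.
Qed.

Section Uniqueness.
Variables (m : nat) (R R' : comPzRingType) (I : lmodType R) (I' : lmodType R').
Variables (D : normdata m I) (D' : normdata m I') (f : nat -> int).
Hypotheses (Df : form_data D f) (Df' : form_data D' f).
Local Notation phi := (ring_transport D D').
Local Notation psi := (module_transport D D').

(** The terms in [f] cancel in the difference of the two sides, which therefore satisfies the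
    homogeneous recurrence of [diagonal_rec_eq0]. It vanishes at the ends because the extended
    families there are 0 and the same integer. *)
Lemma rco_ext_zetaM_uniq i j k :
  (i <= m.+3)%N -> (j <= m.+3)%N -> (0 < k < m.+3)%N ->
  rco D k (ext_zeta D f i * ext_zeta D f j)
    = rco D' k (ext_zeta D' f i * ext_zeta D' f j).
Proof.
move=> hi hj hk; apply/eqP; rewrite -subr_eq0; apply/eqP.
move: i j k hi hj hk; apply: diagonal_rec_eq0.
- by move=> i j k hi hj hk; rewrite !rco_ext_zetaM //; ring.
- by move=> i j k; congr (rco D k _ - rco D' k _); rewrite mulrC.
- by move=> j k; rewrite !mul0r !raddf0 subrr.
move=> j k hj hk; rewrite !ext_zetan !mulrzl (raddfMz (rco D k)) (raddfMz (rco D' k)).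
by rewrite !rco_ext_zeta // subrr.
Qed.

Lemma rco_zetM_pos i j k :
  (i < m.+3)%N -> (j < m.+3)%N -> (0 < k < m.+3)%N ->
  rco D k (zet D i * zet D j) = rco D' k (zet D' i * zet D' j).
Proof.
(* Index 0 is treated directly, since [zet] takes the value 1 there and [ext_zeta] the value 0. *)
have [-> _ hj /andP[_ hk]|i0 hi] := posnP i.
  by rewrite !zet0 !mul1r !rco_zet.
have [-> _ /andP[_ hk]|j0 hj hk] := posnP j.
  by rewrite !zet0 !mulr1 !rco_zet.
rewrite -!(ext_zetaE _ f) ?i0 ?j0 //; apply: rco_ext_zetaM_uniq => //; exact: ltnW.
Qed.

Lemma rco_zetM_uniq i j k :
  (i < m.+3)%N -> (j < m.+3)%N -> (k < m.+3)%N ->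
  rco D k (zet D i * zet D j) = rco D' k (zet D' i * zet D' j).
Proof.
move=> hi hj; have [-> _|k0 hk] := posnP k; last by apply: rco_zetM_pos; rewrite ?k0.
(* Associativity needs a positive index different from [i]; both 1 and 2 are in range because n is
   at least 3. *)
pose l := if i == 1%N then 2%N else 1%N.
have [hl li] : (0 < l < m.+3)%N /\ l != i by rewrite /l; case: eqP; lia.
rewrite !(@rco0_mul _ _ _ _ i j l) //.
by congr (_ - _); apply: eq_bigr => p _; rewrite !rco_zetM_pos //; have := ltn_ord p; lia.
Qed.

Lemma ring_transport_monoid_morphism : monoid_morphism phi.
Proof.
split; first by rewrite -(zet0 D) ring_transport_zet ?zet0.
move=> r s; apply: (rcoP (D := D')) => l hl; rewrite rco_transport // !rcoM.
apply: eq_bigr => k _; apply: eq_bigr => j _.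
by rewrite !rco_transport // rco_zetM_uniq.
Qed.

(** The [alp]-coordinates of [r *: bet D k] are coordinates of [r]. By [bco_qco] the other
    coordinates reduce to [alp]-coordinates of ring multiples of [bet D k] and of [alp D b], and the
    latter is a multiple of [bet D 0]. *)
Lemma module_transport_scale_bet r k : (k < m.+1)%N ->
  psi (r *: bet D k) = phi r *: bet D' k.
Proof.
move=> hk; apply: (icoP (D := D')) => [a ha|p hp].
  by rewrite qco_transport // !qco_scale_bet // rco_transport //; lia.
have [phi1 phiM] := ring_transport_monoid_morphism.
have hp' : (m.+2 - p < m.+3)%N by lia.
rewrite bco_transport // !bco_qco // !scalerA !qco_scale_bet //.
rewrite -(ring_transport_zet D D') // -phiM rco_transport; last by lia.
congr (_ - _); apply: eq_bigr => b _; have hb := ltn_ord b.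
rewrite !qco_scale_bet // rco_transport; last by lia.
rewrite Df.2 // Df'.2 // !scalerA !qco_scale_bet //.
rewrite -(ring_transport_zet D D' (j := m.+2 - b)); last by lia.
by rewrite -phiM rco_transport //; lia.
Qed.

Lemma module_transport_scale r x : psi (r *: x) = phi r *: psi x.
Proof.
have psiB := module_transport_zmod_morphism D D'.
have [_ phiM] := ring_transport_monoid_morphism.
apply: (eq_on_bases (D := D) (g := fun x => psi (r *: x))
  (h := fun x => phi r *: psi x)) => [u v|u v|a ha|k hk] /=.
- by rewrite scalerBr psiB.
- by rewrite psiB scalerBr.
(* As [alp] is a ring multiple of [bet 0] on both sides, this case reduces to
   [module_transport_scale_bet] and multiplicativity. *)
- rewrite module_transport_alp // Df.2 // Df'.2 // !scalerA.
  rewrite module_transport_scale_bet // phiM ring_transport_zet //.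
  by lia.
by rewrite module_transport_scale_bet // module_transport_bet.
Qed.

Lemma form_data_iso :
  exists (phi : {rmorphism R -> R'}) (psi : {additive I -> I'}),
  [/\ bijective phi, bijective psi & forall r v, psi (r *: v) = phi r *: psi v].
Proof.
exists (HB.pack_for {rmorphism R -> R'} phi
  (GRing.isZmodMorphism.Build R R' phi (ring_transport_zmod_morphism D D'))
  (GRing.isMonoidMorphism.Build R R' phi ring_transport_monoid_morphism)).
exists (HB.pack_for {additive I -> I'} psi
  (GRing.isZmodMorphism.Build I I' psi (module_transport_zmod_morphism D D'))).
split=> /=.
- by exists (ring_transport D' D); exact: ring_transportK.
- by exists (module_transport D' D); exact: module_transportK.
- exact: module_transport_scale.
Qed.

End Uniqueness.

(** * The form of a normalized structure *)

Section Normalization.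
Variables (m : nat) (R : comPzRingType) (I : lmodType R) (D : normdata m I).
Local Notation z := (zet D).
Local Notation al := (alp D).
Local Notation be := (bet D).
Local Notation rc := (rco D).
Local Notation qc := (qco D).
Local Notation bc := (bco D).

Section ShiftZeta.
Variable t : nat -> int.
Hypothesis t0 : t 0%N = 0.

(** Translating [z j] by [t j] changes only the coordinate of index 0, which has to give back the
    added integers. *)
Definition shift_rco0 r : int := rc 0 r - \sum_(j < m.+3) t j * rc j r.

Lemma shift_rco0_zmod_morphism : zmod_morphism shift_rco0.
Proof.
move=> r s; rewrite /shift_rco0 raddfB -subrACA; congr (_ - _).
by rewrite -sumrB; apply: eq_bigr => j _; rewrite raddfB mulrBr.
Qed.

Definition shift_rco k : {additive R -> int} :=
  if k is 0 then HB.pack_for {additive R -> int} shift_rco0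
    (GRing.isZmodMorphism.Build R int shift_rco0 shift_rco0_zmod_morphism)
  else rc k.

(** Integer multiples of [be k] have no [al]-coordinate, so integer translations preserve [qco_act].
    The condition [t 0 = 0] keeps the first basis element equal to 1. *)
Lemma shift_zeta : exists D' : normdata m I,
  [/\ forall j, zet D' j = z j + (t j)%:~R, qco D' = qc & bet D' = be].
Proof.
have rco_shift j k : (j < m.+3)%N -> (0 < k < m.+3)%N ->
    rc k (z j + (t j)%:~R) = (j == k).
  move=> hj hk; rewrite raddfD rco_int // addr0 rco_zet //; lia.
have hD1 r : r = \sum_(j < m.+3) (z j + (t j)%:~R) *~ shift_rco j r.
  under eq_bigr => j _ do rewrite mulrzDl.
  rewrite big_split /= !(big_ord_recl m.+2) /= t0 mulr0z mul0rz add0r zet0.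
  rewrite /shift_rco0 big_ord_recl t0 mul0r add0r mulrzBr.
  rewrite {1}[r](rco_sum D) (big_ord_recl m.+2 (fun j : 'I_m.+3 => z j *~ rc j r)) /=.
  rewrite zet0 -!addrA; congr (_ + _).
  rewrite addrCA -[LHS]addr0; congr (_ + _); apply/eqP.
  rewrite addrC eq_sym subr_eq0; apply/eqP; rewrite mulrz_sumr.
  by apply: eq_bigr => j _; rewrite -mulrzA.
have hD2 j k : (j < m.+3)%N -> (k < m.+3)%N ->
    shift_rco k (z j + (t j)%:~R) = (j == k).
  case: k => [|k] hj hk; last exact: rco_shift.
  rewrite /= /shift_rco0 big_ord_recl t0 mul0r add0r.
  have lift_gt0 (i : 'I_m.+2) : (0 < lift ord0 i < m.+3)%N by rewrite lift0 /= ltnS.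
  under eq_bigr => i _ do rewrite rco_shift // mulrC lift0.
  rewrite raddfD rco_zet //= raddfMz -(zet0 D) rco_zet // eqxx intz.
  case: j hj => [|j] hj.
    by rewrite t0 big1 // => i _; rewrite mul0r.
  rewrite (@sum_delta m.+2 j (fun i => t i.+1)) //.
  by rewrite add0r subrr.
have hD3 a j k : (a < 2)%N -> (j < m.+3)%N -> (k < m.+1)%N ->
    qc a ((z j + (t j)%:~R) *: be k) = (a + j + k == m.+2)%N.
  move=> ha hj hk; rewrite scalerDl raddfD qco_act // scaler_int raddfMz.
  by rewrite qco_bet // mul0rz addr0.
have hD4 : z 0 + (t 0%N)%:~R = 1 by rewrite t0 addr0 zet0.
by exists (@NormData m R I (fun j => z j + (t j)%:~R) al be shift_rco qc bc hD1 hD2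
  (ico_sum D) (@qco_alp _ _ _ D) (@qco_bet _ _ _ D) (@bco_alp _ _ _ D)
  (@bco_bet _ _ _ D) hD4 hD3).
Qed.

End ShiftZeta.

Definition new_alp b := z (m.+2 - b)%N *: be 0.

Definition shift_bco_fun k x : int :=
  bc k x - \sum_(a < 2) qc a x * bc k (new_alp a).

Lemma shift_bco_zmod_morphism k : zmod_morphism (shift_bco_fun k).
Proof.
move=> x y; rewrite /shift_bco_fun raddfB -subrACA; congr (_ - _).
by rewrite -sumrB; apply: eq_bigr => j _; rewrite raddfB mulrBl.
Qed.

Definition shift_bco k : {additive I -> int} :=
  HB.pack_for {additive I -> int} (shift_bco_fun k)
    (GRing.isZmodMorphism.Build I int (shift_bco_fun k) (shift_bco_zmod_morphism k)).

(** By [qco_act], [new_alp b] has the same [qc]-coordinates as [al b]. The two differ by a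
    combination of the [be k], so the change of basis is unipotent and affects only [bc]. *)
Lemma change_alp : exists D' : normdata m I,
  [/\ zet D' = z, qco D' = qc, bet D' = be & alp D' = new_alp].
Proof.
have qc_new a b : (a < 2)%N -> (b < 2)%N -> qc a (new_alp b) = (a == b).
  by move=> ha hb; rewrite qco_act //; lia.
have bc_new k a : (k < m.+1)%N -> (a < 2)%N -> shift_bco k (new_alp a) = 0.
  move=> hk ha; rewrite /= /shift_bco_fun.
  rewrite -(@sum_delta 2 a (fun b => bc k (new_alp b))) // -sumrB big1 // => b _.
  by rewrite qc_new // eq_sym subrr.
have bc_bet k l : (k < m.+1)%N -> (l < m.+1)%N -> shift_bco k (be l) = (k == l).
  move=> hk hl; rewrite /= /shift_bco_fun bco_bet // big1 ?subr0 // => a _.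
  by rewrite qco_bet // mul0r.
have hsum x : x = \sum_(a < 2) new_alp a *~ qc a x
                + \sum_(k < m.+1) be k *~ shift_bco k x.
  apply: (icoP (D := D)) => [a ha|k hk]; rewrite raddfD !raddf_sum.
    rewrite [X in _ = _ + X]big1 ?addr0 => [|k _]; last first.
      by rewrite raddfMz qco_bet // mul0rz.
    rewrite -[LHS](@sum_delta 2 a (fun a => qc a x)) //.
    by apply: eq_bigr => b _; rewrite raddfMz qc_new // -mulrzr intz.
  under [X in _ = _ + X]eq_bigr => l _ do
    rewrite raddfMz bco_bet // -mulrzr intz.
  rewrite (@sum_delta m.+1 k (fun k => shift_bco k x)) //=.
  under eq_bigr => a _ do rewrite raddfMz -mulrzr intz mulrC.
  by rewrite /shift_bco_fun addrC subrK.
by exists (@NormData m R I z new_alp be rc qc shift_bco (rco_sum D)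
  (@rco_zet _ _ _ D) hsum qc_new (@qco_bet _ _ _ D) bc_new bc_bet (zet0 D)
  (@qco_act _ _ _ D)).
Qed.

End Normalization.

Section FormOfNormdata.
Variables (m : nat) (R : comPzRingType) (I : lmodType R) (D : normdata m I).
Local Notation z := (zet D).
Local Notation al := (alp D).
Local Notation be := (bet D).
Local Notation qc := (qco D).

Definition trunc_zeta i : R := if (i < m.+3)%N then z i else 0.

Definition slant i w : int := qc 0 (trunc_zeta i.+1 *: w) - qc 1 (trunc_zeta i *: w).

(* Both terms of slant i agree on the bet k. *)
Lemma slantE i w : (i < m.+3)%N ->
  slant i w = slant i (al 0) * qc 0 w + slant i (al 1) * qc 1 w.
Proof.
move=> hi; apply: (eq_on_bases (D := D) (g := slant i)
    (h := fun w => slant i (al 0) * qc 0 w + slant i (al 1) * qc 1 w)) => [x y|x y|a|k hk].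
- by rewrite /slant !scalerBr (raddfB (qc 0)) (raddfB (qc 1)) subrACA.
- by rewrite !raddfB !mulrBr opprD addrACA.
- case: a => [|[|]] // _; rewrite !qco_alp //=; ring.
rewrite !qco_bet // !mulr0 addr0 /slant /trunc_zeta hi qco_act //.
case: ifP => hi1; last by rewrite scale0r raddf0; lia.
by rewrite qco_act //; lia.
Qed.

Lemma exists_form_data : exists (D' : normdata m I) (f : nat -> int), form_data D' f.
Proof.
have [u [v uvE]] : exists u v : nat -> int, forall i w, (i < m.+3)%N ->
    slant i w = u i * qc 0 w + v i * qc 1 w.
  by exists (slant^~ (al 0)), (slant^~ (al 1)) => i w; exact: slantE.
(* Adding [- u i] to [z i.+1] cancels the term [u i * qc 0 w] of [slant i w]. *)
pose t i : int := if i is j.+1 then - u j else 0.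
have [D1 [zE1 qE1 bE1]] := shift_zeta D (erefl : t 0%N = 0).
have [D2 [zE2 qE2 bE2 aE2]] := change_alp D1.
(* The summand [- t i] compensates the translation of [z i] under [qc 1], and the extra 1 at [i = 0]
   the replacement of [z 0 = 1] by 0. The last coefficient is [u m.+2], because [ext_zeta] takes the
   value [- f m.+3] in place of the truncated 0. *)
pose f i : int := if i == m.+3 then u m.+2 else v i - t i + (i == 0%N)%:Z.
exists D2, f; split; last by move=> b hb; rewrite aE2 zE2 bE2.
move=> i w hi; rewrite qE2 qE1 /ext_zeta zE2 !zE1 /= eqSS.
have := uvE i w hi; rewrite /slant /trunc_zeta hi ltnS.
rewrite /f eqxx (ltn_eqF hi).
have [->|im] := eqVneq i m.+2.
  rewrite ltnn scale0r raddf0 sub0r /= !(scalerDl, scaler_int) !(raddfD, raddfMz) /=.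
  rewrite !mulrzz; move: (qc 0 w) (qc 1 w) (qc 1 _) => q0 q1 q2 E.
  by rewrite -[q2]opprK E; ring.
have -> : (i < m.+2)%N by lia.
have [->|i0] := eqVneq i 0%N.
  rewrite scale0r raddf0 zet0 scale1r scalerDl raddfD scaler_int raddfMz.
  rewrite mulrzz /t /=; move: (qc 0 w) (qc 1 w) (qc 0 _) => q0 q1 q2 E.
  by rewrite -[q2](subrK q1) E; ring.
rewrite !(scalerDl, scaler_int) !(raddfD, raddfMz) !mulrzz.
move: (qc 0 w) (qc 1 w) (qc 0 _) (qc 1 _) => q0 q1 q2 q3 E.
by rewrite -[q2](subrK q3) E /=; ring.
Qed.

End FormOfNormdata.

(** * Laurent monomials *)

Local Notation ix := (@Ordinal 2 0 isT).
Local Notation iy := (@Ordinal 2 1 isT).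

Definition mono2 (a b : nat) : 'X_{1..2} := [multinom if k == ix then a else b | k < 2].

Lemma mono2E (mu : 'X_{1..2}) : mu = mono2 (mu ix) (mu iy).
Proof.
apply/mnmP => k; rewrite mnmE; case: eqP => [->//|]; case: k => [[|[|]]] // hk H.
  by case: H; exact: val_inj.
by congr (mu _); exact: val_inj.
Qed.

Lemma mono2_eq a b c d : (mono2 a b == mono2 c d) = (a == c) && (b == d).
Proof.
apply/eqP/andP => [/mnmP E|[/eqP-> /eqP->]] //.
by have := E ix; have := E iy; rewrite !mnmE /= => -> ->.
Qed.

Lemma varxE : varx = 'X_[mono2 1 0].
Proof.
congr ('X_[_]); apply/mnmP => k; rewrite !mnmE eq_sym.
by case: eqP.
Qed.

Lemma varyE : vary = 'X_[mono2 0 1].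
Proof.
congr ('X_[_]); apply/mnmP => k; rewrite !mnmE.
by case: k => [[|[|]]].
Qed.

Lemma mono2_varE a b : 'X_[mono2 a b] = varx ^+ a * vary ^+ b :> {mpoly int[2]}.
Proof.
rewrite varxE varyE !mpolyXn -mpolyXD; congr ('X_[_]).
by apply/mnmP => k; rewrite mnmDE !mulmnE !mnmE; case: eqP => _; lia.
Qed.

(** Integer exponents, with value 0 at negative ones, let multiplication by a monomial act as a
    plain shift. *)
Definition gcoef (i j : int) (g : {mpoly int[2]}) : int :=
  match i, j with Posz a, Posz b => g@_(mono2 a b) | _, _ => 0 end.

Lemma gcoef_zmod_morphism i j : zmod_morphism (gcoef i j).
Proof.
by move=> g h; case: i j => [a|a] [b|b] /=; rewrite ?subr0 // mcoeffB.
Qed.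

HB.instance Definition _ i j :=
  GRing.isZmodMorphism.Build {mpoly int[2]} int (gcoef i j) (gcoef_zmod_morphism i j).

Lemma gcoefZ i j c g : gcoef i j (c *: g) = c * gcoef i j g.
Proof. by case: i j => [a|a] [b|b] /=; rewrite ?mulr0 // mcoeffZ. Qed.

Lemma gcoefX i j mu : gcoef i j 'X_[mu] = ((mu ix)%:Z == i) && ((mu iy)%:Z == j).
Proof.
case: i j => [a|a] [b|b] /=; rewrite ?andbF //.
by rewrite mcoeffX {1}[mu]mono2E mono2_eq natz.
Qed.

Lemma gcoefMX i j a b g :
  gcoef i j (g * 'X_[mono2 a b]) = gcoef (i - a%:Z) (j - b%:Z) g.
Proof.
rewrite [in LHS](mpolyE g) [in RHS](mpolyE g) mulr_suml !raddf_sum; apply: eq_bigr => mu _.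
rewrite /= -scalerAl -mpolyXD !gcoefZ !gcoefX !mnmDE !mnmE /=.
by congr (_ * (nat_of_bool _)%:Z); rewrite !PoszD; lia.
Qed.

Lemma gcoef_eq0 i j g : (i < 0) || (j < 0) -> gcoef i j g = 0.
Proof. by case: i j => [a|a] [b|b]. Qed.

Local Notation X := (varx%:F : Kxy).
Local Notation Y := (vary%:F : Kxy).
Local Notation XY := ((varx * vary)%:F : Kxy).

Lemma X_neq0 : X != 0. Proof. by rewrite tofrac_eq0 varx_neq0. Qed.
Lemma Y_neq0 : Y != 0. Proof. by rewrite tofrac_eq0 vary_neq0. Qed.
Lemma XY_neq0 : XY != 0. Proof. by rewrite tofrac_eq0 varxy_neq0. Qed.

(** The coefficient of x^i y^j in a Laurent polynomial, with default 0 on fractions that are not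
    Laurent polynomials. It is read from a chosen representation, so additivity is only stated for
    sections over D_+(xy). *)
Definition lcoef (i j : int) (s : Kxy) : int :=
  match pselect (exists mg : nat * {mpoly int[2]}, s = mg.2%:F / XY ^+ mg.1) with
  | left h => let mg := sval (cid h) in gcoef (i + mg.1%:Z) (j + mg.1%:Z) mg.2
  | right _ => 0
  end.

Lemma varxyX m : (varx * vary) ^+ m = 'X_[mono2 m m].
Proof. by rewrite mono2_varE exprMn. Qed.

(** Cross-multiplying two representations gives an equality of polynomials, whose coefficients are
    compared at exponents shifted by [m + m']. *)
Lemma lcoefE i j m g : lcoef i j (g%:F / XY ^+ m) = gcoef (i + m%:Z) (j + m%:Z) g.
Proof.
rewrite /lcoef; case: pselect => [h|[]]; last by exists (m, g).
case: (cid h) => -[m' g'] /= /eqP.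
rewrite eqr_div ?expf_neq0 ?XY_neq0 // -!rmorphXn -!rmorphM tofrac_eq => /eqP E.
have := congr1 (gcoef (i + m%:Z + m'%:Z) (j + m%:Z + m'%:Z)) E.
rewrite !varxyX !gcoefMX => E'.
rewrite [RHS](_ : _ = gcoef (i + m%:Z + m'%:Z - m'%:Z)
    (j + m%:Z + m'%:Z - m'%:Z) g).
  by rewrite E'; congr (gcoef _ _ _); lia.
by congr (gcoef _ _ _); lia.
Qed.

Lemma lcoefB k i j s t : s \in sec_xy k -> t \in sec_xy k ->
  lcoef i j (s - t) = lcoef i j s - lcoef i j t.
Proof.
move=> /asboolP[m [d [g [_ _ ->]]]] /asboolP[m' [d' [g' [_ _ ->]]]].
rewrite !lcoefE divX_sub ?XY_neq0 // -!rmorphXn -!rmorphM -rmorphB.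
rewrite rmorphXn lcoefE.
rewrite raddfB /= !varxyX !gcoefMX.
by congr (gcoef _ _ _ - gcoef _ _ _); lia.
Qed.

Lemma lcoef0 i j : lcoef i j 0 = 0.
Proof. by have := lcoefE i j 0 0; rewrite tofrac0 mul0r raddf0. Qed.

Lemma lcoefD k i j s t : s \in sec_xy k -> t \in sec_xy k ->
  lcoef i j (s + t) = lcoef i j s + lcoef i j t.
Proof.
move=> hs ht; rewrite -[t in LHS]opprK (lcoefB _ _ hs) ?rpredN //.
by rewrite -[- t]sub0r (lcoefB _ _ _ ht) ?rpred0 // lcoef0 sub0r opprK.
Qed.

Lemma lcoefMz k i j s c : s \in sec_xy k -> lcoef i j (s *~ c) = lcoef i j s * c.
Proof.
move=> /asboolP[m [d [g [_ _ ->]]]].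
have -> : (g%:F / XY ^+ m) *~ c = (g *~ c)%:F / XY ^+ m.
  by rewrite -mulrzAl raddfMz.
by rewrite !lcoefE raddfMz mulrzz.
Qed.

Lemma lcoefXM k i j s : s \in sec_xy k -> lcoef i j (X * s) = lcoef (i - 1) j s.
Proof.
move=> /asboolP[m [d [g [_ _ ->]]]]; rewrite mulrA -rmorphM !lcoefE mulrC varxE.
by rewrite gcoefMX; congr (gcoef _ _ _); lia.
Qed.

Lemma lcoefYM k i j s : s \in sec_xy k -> lcoef i j (Y * s) = lcoef i (j - 1) s.
Proof.
move=> /asboolP[m [d [g [_ _ ->]]]]; rewrite mulrA -rmorphM !lcoefE mulrC varyE.
by rewrite gcoefMX; congr (gcoef _ _ _); lia.
Qed.

(** Only x is inverted over D_+(x), so y never occurs with a negative exponent. *)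
Lemma lcoef_sec_x k i j s : j < 0 -> s \in sec_x k -> lcoef i j s = 0.
Proof.
move=> j0 /asboolP[m [d [g [_ _ ->]]]].
have -> : g%:F / X ^+ m = (g * 'X_[mono2 0 m])%:F / XY ^+ m.
  rewrite mono2_varE expr0 mul1r rmorphM rmorphXn rmorphM exprMn -mulf_div.
  by rewrite divff ?mulr1 // expf_neq0 // Y_neq0.
by rewrite lcoefE gcoefMX gcoef_eq0 //; lia.
Qed.

Lemma lcoef_sec_y k i j s : i < 0 -> s \in sec_y k -> lcoef i j s = 0.
Proof.
move=> i0 /asboolP[m [d [g [_ _ ->]]]].
have -> : g%:F / Y ^+ m = (g * 'X_[mono2 m 0])%:F / XY ^+ m.
  rewrite mono2_varE expr0 mulr1 !rmorphM rmorphXn exprMn [X ^+ m * Y ^+ m]mulrC.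
  by rewrite -mulf_div divff ?mulr1 // expf_neq0 // X_neq0.
by rewrite lcoefE gcoefMX gcoef_eq0 //; lia.
Qed.

Definition lmon (i j : int) : Kxy := X ^ i * Y ^ j.

Lemma exprz_mulACA (F : fieldType) (x y : F) (i j i' j' : int) : x != 0 -> y != 0 ->
  x ^ i * y ^ j * (x ^ i' * y ^ j') = x ^ (i + i') * y ^ (j + j').
Proof. by move=> x0 y0; rewrite mulrACA !expfzDr. Qed.

Lemma exprz_subn (F : fieldType) (x y : F) (a b m : nat) : x != 0 -> y != 0 ->
  x ^ (a%:Z - m%:Z) * y ^ (b%:Z - m%:Z) = (x ^+ a * y ^+ b) / (x * y) ^+ m.
Proof.
move=> x0 y0; rewrite !expfzDr // -!exprnN -!exprnP exprMn invfM.
by rewrite mulrACA.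
Qed.

Lemma lmonM i j i' j' : lmon i j * lmon i' j' = lmon (i + i') (j + j').
Proof. exact: exprz_mulACA X_neq0 Y_neq0. Qed.

Lemma lmon_X : lmon 1 0 = X. Proof. by rewrite /lmon expr1z expr0z mulr1. Qed.
Lemma lmon_Y : lmon 0 1 = Y. Proof. by rewrite /lmon expr1z expr0z mul1r. Qed.
Lemma lmon00 : lmon 0 0 = 1. Proof. by rewrite /lmon !expr0z mulr1. Qed.

Lemma lmonE m (a b : nat) :
  lmon (a%:Z - m%:Z) (b%:Z - m%:Z) = ('X_[mono2 a b])%:F / XY ^+ m.
Proof.
rewrite mono2_varE !rmorphM !rmorphXn.
exact: exprz_subn X_neq0 Y_neq0.
Qed.

Lemma int_subn (i : int) : exists a m : nat, i = a%:Z - m%:Z.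
Proof. by case: i => a; [exists a, 0%N | exists 0%N, a.+1]; lia. Qed.

Lemma int_subn2 (i j : int) : exists a b m : nat, i = a%:Z - m%:Z /\ j = b%:Z - m%:Z.
Proof.
have [a [m ->]] := int_subn i; have [b [m' ->]] := int_subn j.
by exists (a + m')%N, (b + m)%N, (m + m')%N; split; lia.
Qed.

Lemma varxyX_homog a b : varx ^+ a * vary ^+ b \is (a + b).-homog.
Proof.
rewrite -[a in (a + _).-homog]mul1n -[b in (_ + b).-homog]mul1n.
by apply: dhomogM; apply: dhomogMn; [exact: varx_homog | exact: vary_homog].
Qed.

Lemma lmon_sec_x i j : 0 <= j -> lmon i j \in sec_x (i + j).
Proof.
case: j => // b _; have [a [m ->]] := int_subn i; apply/asboolP.
exists m, (a + b)%N, (varx ^+ a * vary ^+ b); split.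
- by lia.
- exact: varxyX_homog.
rewrite /lmon expfzDr ?X_neq0 // -exprnN -!exprnP rmorphM !rmorphXn.
exact: mulrAC.
Qed.

Lemma lmon_sec_y i j : 0 <= i -> lmon i j \in sec_y (i + j).
Proof.
case: i => // a _; have [b [m ->]] := int_subn j; apply/asboolP.
exists m, (a + b)%N, (varx ^+ a * vary ^+ b); split.
- by lia.
- exact: varxyX_homog.
rewrite /lmon expfzDr ?Y_neq0 // -exprnN -!exprnP rmorphM !rmorphXn.
exact: mulrA.
Qed.

Lemma lmon_sec_xy i j : lmon i j \in sec_xy (i + j).
Proof.
have [a [b [m [-> ->]]]] := int_subn2 i j; rewrite lmonE mono2_varE.
apply/asboolP; exists m, (a + b)%N, (varx ^+ a * vary ^+ b).
by split; [lia | exact: varxyX_homog | ].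
Qed.

Lemma lcoef_lmon i j i' j' : lcoef i j (lmon i' j') = (i' == i) && (j' == j).
Proof.
have [a [b [m [-> ->]]]] := int_subn2 i' j'.
rewrite lmonE lcoefE gcoefX !mnmE /=.
by congr ((nat_of_bool _)%:Z); lia.
Qed.

(** Induction over the monomials of [s]. The last premise keeps the coefficients of [s] itself, so
    that vanishing results for them can be used. *)
Lemma sec_xy_ind k s (P : Kxy -> Prop) : s \in sec_xy k ->
  P 0 -> (forall u v, P u -> P v -> P (u + v)) ->
  (forall i j : int, i + j = k -> P (lmon i j *~ lcoef i j s)) -> P s.
Proof.
move=> hs P0 PD Pm; have /asboolP[m [d [g [Ed gd Es]]]] := hs.
have -> : s = \sum_(mu <- msupp g) lmon ((mu ix)%:Z - m%:Z) ((mu iy)%:Z - m%:Z)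
     *~ lcoef ((mu ix)%:Z - m%:Z) ((mu iy)%:Z - m%:Z) s.
  rewrite {1}Es {1}[g]mpolyE raddf_sum mulr_suml; apply: eq_bigr => mu _.
  rewrite lmonE Es lcoefE !subrK /= -mono2E.
  by rewrite -[g@_mu in LHS]intz scaler_int raddfMz mulrzAl.
rewrite big_seq; elim/big_ind: _ => // mu mu_g; apply: Pm.
have := dhomog_mf gd mu_g; rewrite /= mdegE !big_ord_recl big_ord0 addn0.
rewrite (_ : lift ord0 ord0 = iy); last exact: val_inj.
rewrite (_ : ord0 = ix); last exact: val_inj.
by lia.
Qed.

(** * A basis of the hypercohomology *)

(** This is the computation of H^1(P^1, O(-d-1)): a monomial with a nonnegative exponent extends to
    one of the two charts, which leaves the [d] monomials with both exponents negative. *)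
Lemma sec_xy_mid d s : s \in sec_xy (- d.+1%:Z) -> exists (c : nat -> int) sx sy,
  [/\ sx \in sec_x (- d.+1%:Z), sy \in sec_y (- d.+1%:Z)
    & s = \sum_(a < d) lmon (- a.+1%:Z) (- d.+1%:Z + a.+1%:Z) *~ c a + (sy - sx)].
Proof.
move=> hs; pattern s; apply: (sec_xy_ind hs).
- exists (fun=> 0), 0, 0; split; rewrite ?rpred0 // subrr addr0 big1 //.
- move=> u v [c [sx [sy [hx hy ->]]]] [c' [sx' [sy' [hx' hy' ->]]]].
  exists (fun a => c a + c' a), (sx + sx'), (sy + sy'); split; rewrite ?rpredD //.
  under [X in _ = X + _]eq_bigr => a _ do rewrite mulrzDr.
  by rewrite big_split /= opprD addrACA [X in _ = _ + X]addrACA.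
move=> i j ijE; set c := lcoef _ _ _.
have [i0|i0] := leP 0 i.
  exists (fun=> 0), 0, (lmon i j *~ c); rewrite rpred0 rpredMz -?ijE ?lmon_sec_y //.
  split=> //; rewrite subr0 big1 ?add0r //.
have [j0|j0] := leP 0 j.
  exists (fun=> 0), (- (lmon i j *~ c)), 0; rewrite rpred0 rpredN rpredMz -?ijE ?lmon_sec_x //.
  split=> //; rewrite sub0r opprK big1 ?add0r //.
pose a0 := `|i|.-1%N; have a0d : (a0 < d)%N by lia.
exists (fun a => if a == a0 then c else 0), 0, 0; rewrite !rpred0; split=> //.
rewrite subrr addr0 (bigD1 (Ordinal a0d)) //= eqxx big1 ?addr0 => [|a].
  by congr (lmon _ _ *~ c); lia.
by rewrite -val_eqE /= => /negPf ->; rewrite /= mulr0z.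
Qed.

(** H^0(P^1, O(k)) vanishes, as a monomial of negative degree has a negative exponent and so fails
    to extend to one of the charts. *)
Lemma sec_cap_neg k s : k < 0 -> s \in sec_x k -> s \in sec_y k -> s = 0.
Proof.
move=> k0 hx hy; pattern s; apply: (sec_xy_ind (sec_x_xy hx)) => // [u v -> ->|i j ijE].
  by rewrite addr0.
have [i0|i0] := ltP i 0; first by rewrite (lcoef_sec_y _ i0 hy) mulr0z.
by rewrite (lcoef_sec_x _ _ hx) ?mulr0z //; lia.
Qed.

Lemma sec_cap e s : s \in sec_x e%:Z -> s \in sec_y e%:Z ->
  exists c : nat -> int, s = \sum_(b < e.+1) lmon b%:Z (e%:Z - b%:Z) *~ c b.
Proof.
move=> hx hy; pattern s; apply: (sec_xy_ind (sec_x_xy hx)) => // [|u v [c ->] [c' ->]|i j ijE].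
- by exists (fun=> 0); rewrite big1 //.
- exists (fun a => c a + c' a).
  by rewrite -big_split /=; apply: eq_bigr => a _; rewrite mulrzDr.
have zero c : c = 0 -> exists c' : nat -> int,
    lmon i j *~ c = \sum_(b < e.+1) lmon b%:Z (e%:Z - b%:Z) *~ c' b.
  by move=> ->; exists (fun=> 0); rewrite mulr0z big1 //.
have [i0|i0] := ltP i 0; first by apply: zero; rewrite (lcoef_sec_y _ i0 hy).
have [j0|j0] := ltP j 0; first by apply: zero; rewrite (lcoef_sec_x _ j0 hx).
set c := lcoef _ _ _.
pose b0 := `|i|%N; have b0e : (b0 < e.+1)%N by lia.
exists (fun b => if b == b0 then c else 0).
rewrite (bigD1 (Ordinal b0e)) //= eqxx big1 ?addr0 => [|a].
  by congr (lmon _ _ *~ c); lia.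
by rewrite -val_eqE /= => /negPf ->; rewrite /= mulr0z.
Qed.

Section Classes.
Variables (n : nat) (f : binary_form n).
Local Notation F := ((form_poly f)%:F : Kxy).

Lemma form_polyE : F = \sum_(l < n.+1) lmon (n%:Z - l%:Z) l%:Z *~ f l.
Proof.
rewrite /form_poly raddf_sum; apply: eq_bigr => l _.
rewrite -[f l in LHS]intz scaler_int raddfMz /= /lmon rmorphM !rmorphXn.
have -> : n%:Z - l%:Z = (n - l)%N%:Z by have := ltn_ord l; lia.
by [].
Qed.

Lemma form_poly_mul i j :
  F * lmon i j = \sum_(l < n.+1) lmon (i + n%:Z - l%:Z) (j + l%:Z) *~ f l.
Proof.
rewrite form_polyE mulr_suml; apply: eq_bigr => l _; rewrite mulrzAl lmonM.
by congr (lmon _ _ *~ _); ring.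
Qed.

Lemma form_poly_sec_x k s : s \in sec_x (k - n%:Z) -> F * s \in sec_x k.
Proof.
move=> hs; have hF : F \in sec_x n%:Z by exact: sections_poly (form_homog f).
by have := sec_xM hF hs; rewrite addrC subrK.
Qed.

Lemma form_poly_sec_y k s : s \in sec_y (k - n%:Z) -> F * s \in sec_y k.
Proof.
move=> hs; have hF : F \in sec_y n%:Z by exact: sections_poly (form_homog f).
by have := sec_yM hF hs; rewrite addrC subrK.
Qed.

(** The product of the form with x^i y^j is split by the sign of the exponent of x. When its degree
    is nonnegative, terms with exponent at most 0 have a nonnegative exponent of y and live over
    D_+(x). Terms free of x go to [lift_x], which is what makes [lift_zeta 0] vanish and
    [lift_zeta n] equal to [- form_coef n]. *)
Definition lift_y i j : Kxy :=
  \sum_(l < n.+1 | 0 < i + n%:Z - l%:Z) lmon (i + n%:Z - l%:Z) (j + l%:Z) *~ f l.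
Definition lift_x i j : Kxy :=
  - \sum_(l < n.+1 | ~~ (0 < i + n%:Z - l%:Z)) lmon (i + n%:Z - l%:Z) (j + l%:Z) *~ f l.

Variable e : nat.

Definition lift_val i : Kxy * Kxy * Kxy :=
  let j := e%:Z - n%:Z - i in (lmon i j, lift_x i j, lift_y i j).

Lemma lift_is_cocycle i : is_cocycle f e%:Z (lift_val i).
Proof.
rewrite /lift_val; set j := _ - i; apply/and4P; rewrite /=; split.
- have <- : i + j = e%:Z - n%:Z by rewrite /j; ring.
  exact: lmon_sec_xy.
- rewrite rpredN; apply: rpred_sum => l hl; rewrite rpredMz //.
  have -> : e%:Z = (i + n%:Z - l%:Z) + (j + l%:Z) by rewrite /j; ring.
  by apply: lmon_sec_x; rewrite /j; lia.
- apply: rpred_sum => l hl; rewrite rpredMz //.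
  have -> : e%:Z = (i + n%:Z - l%:Z) + (j + l%:Z) by rewrite /j; ring.
  by apply: lmon_sec_y; rewrite /j; lia.
by rewrite opprK form_poly_mul [X in _ == X](bigID (fun l : 'I_n.+1 => 0 < i + n%:Z - l%:Z)).
Qed.

Definition lift_cocycle i : cocycle f e%:Z := Cocycle (lift_is_cocycle i).

Definition poly_val (s : Kxy) : Kxy * Kxy * Kxy := (0, s, s).

Lemma poly_is_cocycle (b : 'I_e.+1) :
  is_cocycle f e%:Z (poly_val (lmon b%:Z (e%:Z - b%:Z))).
Proof.
set s := lmon _ _; have E : e%:Z = b%:Z + (e%:Z - b%:Z) by ring.
have be := ltn_ord b.
apply/and4P; rewrite /= rpred0 subrr mulr0; split=> //; rewrite /s.
  by rewrite [X in sec_x X]E; apply: lmon_sec_x; lia.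
by rewrite [X in sec_y X]E; apply: lmon_sec_y.
Qed.

Definition poly_cocycle b : cocycle f e%:Z := Cocycle (poly_is_cocycle b).

Lemma overlap_zmod_morphism : zmod_morphism (fun u : cocycle f e%:Z => (val u).1.1).
Proof. by move=> u v; rewrite raddfB. Qed.
Lemma on_x_zmod_morphism : zmod_morphism (fun u : cocycle f e%:Z => (val u).1.2).
Proof. by move=> u v; rewrite raddfB. Qed.
Lemma on_y_zmod_morphism : zmod_morphism (fun u : cocycle f e%:Z => (val u).2).
Proof. by move=> u v; rewrite raddfB. Qed.

Definition overlap : {additive cocycle f e%:Z -> Kxy} := HB.pack_for
  {additive cocycle f e%:Z -> Kxy} (fun u : cocycle f e%:Z => (val u).1.1)
  (GRing.isZmodMorphism.Build _ _ _ overlap_zmod_morphism).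
Definition on_x : {additive cocycle f e%:Z -> Kxy} := HB.pack_for
  {additive cocycle f e%:Z -> Kxy} (fun u : cocycle f e%:Z => (val u).1.2)
  (GRing.isZmodMorphism.Build _ _ _ on_x_zmod_morphism).
Definition on_y : {additive cocycle f e%:Z -> Kxy} := HB.pack_for
  {additive cocycle f e%:Z -> Kxy} (fun u : cocycle f e%:Z => (val u).2)
  (GRing.isZmodMorphism.Build _ _ _ on_y_zmod_morphism).

Lemma cocycleP (u : cocycle f e%:Z) :
  [/\ overlap u \in sec_xy (e%:Z - n%:Z), on_x u \in sec_x e%:Z, on_y u \in sec_y e%:Z
    & on_y u - on_x u = F * overlap u].
Proof. by case: u => v hv; have /and4P[h1 h2 h3 /eqP h4] := hv. Qed.

Lemma coboundaryP (u : cocycle f e%:Z) : is_coboundary u <->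
  exists cx cy : Kxy, [/\ cx \in sec_x (e%:Z - n%:Z), cy \in sec_y (e%:Z - n%:Z),
    overlap u = cy - cx, on_x u = F * cx & on_y u = F * cy].
Proof.
split=> [/asboolP[cx [cy [hx hy E]]]|[cx [cy [hx hy E1 E2 E3]]]].
  by exists cx, cy; rewrite /= E.
apply/asboolP; exists cx, cy; split=> //; rewrite -E1 -E2 -E3 /=.
by case: (cocycle_val u) => [[]].
Qed.

Definition hcoef_fun i (x : H0 f e%:Z) : int :=
  lcoef i (e%:Z - n%:Z - i) (overlap (repr x)).

(** In this range both exponents are negative, whereas every monomial of a coboundary's overlap
    component extends to one of the charts. *)
Lemma hcoef_funE i (u : cocycle f e%:Z) : e%:Z - n%:Z < i < 0 ->
  hcoef_fun i (\pi_(H0 f e%:Z) u) = lcoef i (e%:Z - n%:Z - i) (overlap u).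
Proof.
move=> hi; rewrite /hcoef_fun; set u' := repr _.
have hu : is_coboundary (u' - u) by apply/H0_eqP; rewrite reprK.
have /coboundaryP[cx [cy [hx hy E _ _]]] := hu.
have [h1 _ _ _] := cocycleP u; have [h1' _ _ _] := cocycleP u'.
apply/eqP; rewrite -subr_eq0 -(lcoefB _ _ h1' h1) -raddfB E.
rewrite (lcoefB _ _ (sec_y_xy hy) (sec_x_xy hx)).
rewrite (lcoef_sec_y _ _ hy) ?(lcoef_sec_x _ _ hx) ?subrr //; lia.
Qed.

Lemma hcoef_zmod_morphism i : e%:Z - n%:Z < i < 0 -> zmod_morphism (hcoef_fun i).
Proof.
move=> hi x y; have [u ->] := H0_surj x; have [v ->] := H0_surj y.
rewrite -H0_piB !hcoef_funE // raddfB.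
have [h1 _ _ _] := cocycleP u; have [h1' _ _ _] := cocycleP v.
exact: lcoefB h1 h1'.
Qed.

Variable d : nat.
Hypothesis nE : n = (e + d).+1.

Definition H0_basis (s : 'I_d + 'I_e.+1) : H0 f e%:Z :=
  match s with
  | inl a => \pi_(H0 f e%:Z) (lift_cocycle (- a.+1%:Z))
  | inr b => \pi_(H0 f e%:Z) (poly_cocycle b)
  end.

(** The proof follows 0 -> H^0(O(e)) -> H^0(O(e-n) -> O(e)) -> H^1(O(e-n)) -> 0: the [inr] elements
    come from the monomial basis on the left, and the [inl] elements lift that on the right, of rank
    [d] since e - n = -d - 1. *)
Lemma H0_basis_is_Zbasis : is_Zbasis H0_basis.
Proof.
have enE : e%:Z - n%:Z = - d.+1%:Z by lia.
apply: is_Zbasis_free => [x|c].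
  have [u ->] := H0_surj x; have [h1 h2 h3 h4] := cocycleP u.
  move: (h1); rewrite enE => /sec_xy_mid[c [sx [sy [hx hy Eu]]]].
  rewrite -enE in hx hy.
  pose v := u - \sum_(a < d) lift_cocycle (- a.+1%:Z) *~ c a.
  have v1 : overlap v = sy - sx.
    rewrite /v raddfB raddf_sum Eu -[RHS]add0r addrAC; congr (_ + _).
    apply/eqP; rewrite subr_eq0; apply/eqP; apply: eq_bigr => a _.
    by rewrite raddfMz /= enE opprK.
  have [_ hv2 hv3 hv4] := cocycleP v.
  (* The overlap component of [v] is that of the coboundary of [(sx, sy)]; removing this coboundary
     leaves two chart sections that agree, that is, a global section of O(e). *)
  have E : on_y v - F * sy = on_x v - F * sx.
    by rewrite -[on_y v](subrK (on_x v)) hv4 v1; ring.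
  have [p Ep] : exists p : nat -> int,
      on_x v - F * sx = \sum_(b < e.+1) lmon b%:Z (e%:Z - b%:Z) *~ p b.
    apply: sec_cap; first by rewrite rpredB // form_poly_sec_x.
    by rewrite -E rpredB // form_poly_sec_y.
  exists (fun s : 'I_d + 'I_e.+1 => match s with inl a => c a | inr b => p b end).
  rewrite big_sumType /=.
  have -> : \sum_(a < d) \pi_(H0 f e%:Z) (lift_cocycle (- a.+1%:Z)) *~ c a =
      \pi_(H0 f e%:Z) (u - v).
    by rewrite /v subKr raddf_sum; apply: eq_bigr => a _; rewrite raddfMz.
  have -> : \sum_(b < e.+1) \pi_(H0 f e%:Z) (poly_cocycle b) *~ p b =
      \pi_(H0 f e%:Z) (\sum_(b < e.+1) poly_cocycle b *~ p b).
    by rewrite raddf_sum; apply: eq_bigr => a _; rewrite raddfMz.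
  rewrite -raddfD; apply/H0_eqP; rewrite opprD addrA subKr.
  apply/coboundaryP; exists sx, sy; split=> //; rewrite raddfB raddf_sum.
  - by rewrite v1 big1 ?subr0 // => b _; rewrite raddfMz mul0rz.
  - under eq_bigr => b _ do rewrite raddfMz /=.
    by rewrite -Ep subKr.
  - under eq_bigr => b _ do rewrite raddfMz /=.
    by rewrite -Ep -E subKr.
rewrite big_sumType /= => E.
have c0 a : c (inl a) = 0.
  have hi : e%:Z - n%:Z < - a.+1%:Z < 0 by have := ltn_ord a; lia.
  have [h hE] : exists h : {additive H0 f e%:Z -> int},
      forall x, h x = hcoef_fun (- a.+1%:Z) x.
    by exists (HB.pack_for {additive H0 f e%:Z -> int} (hcoef_fun (- a.+1%:Z))
      (GRing.isZmodMorphism.Build _ _ _ (hcoef_zmod_morphism hi))).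
  have := congr1 h E; rewrite raddf0 raddfD !raddf_sum.
  rewrite (bigD1 a) //= raddfMz hE hcoef_funE // lcoef_lmon !eqxx mulrzz mul1r.
  rewrite big1 ?addr0 => [|a' a'a]; last first.
    rewrite raddfMz hE hcoef_funE // lcoef_lmon.
    case: andP => [[/eqP aa _]|_]; last by rewrite mul0rz.
    by case/eqP: a'a; apply: val_inj => /=; lia.
  rewrite big1 ?addr0 // => b _.
  by rewrite raddfMz hE hcoef_funE //= lcoef0 mul0rz.
rewrite big1 ?add0r in E; last by move=> a _; rewrite c0 mulr0z.
have : is_coboundary (\sum_(b < e.+1) poly_cocycle b *~ c (inr b) - 0).
  apply/H0_eqP; rewrite raddf0 raddf_sum -[RHS]E; apply: eq_bigr => b _.
  by rewrite raddfMz.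
rewrite subr0 => /coboundaryP[cx [cy [hx hy]]]; rewrite !raddf_sum.
rewrite big1 => [|b _]; last by rewrite raddfMz mul0rz.
move=> /esym/eqP; rewrite subr_eq0 => /eqP Ec; rewrite Ec in hy.
(* A coboundary with zero overlap component comes from a global section of O(e-n), which is 0
   because e - n is negative. *)
have cx0 : cx = 0 by apply: sec_cap_neg hx hy; lia.
rewrite cx0 mulr0 => E2 _.
case=> [a|b]; first exact: c0.
have hs : forall b : 'I_e.+1, lmon b%:Z (e%:Z - b%:Z) \in sec_xy e%:Z.
  move=> b'; have Eb : e%:Z = b'%:Z + (e%:Z - b'%:Z) by ring.
  by rewrite [X in sec_xy X]Eb; exact: lmon_sec_xy.
(* As [lcoef] is additive only on sections, membership is carried along the sum together with the
   value. *)
have lsum : forall P : pred 'I_e.+1, lcoef b%:Z (e%:Z - b%:Z)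
    (\sum_(b' < e.+1 | P b') lmon b'%:Z (e%:Z - b'%:Z) *~ c (inr b')) =
    \sum_(b' < e.+1 | P b') (b' == b)%:Z * c (inr b').
  move=> P; pose Q (s : Kxy) (t : int) := s \in sec_xy e%:Z /\ lcoef b%:Z (e%:Z - b%:Z) s = t.
  suff [] : Q (\sum_(b' < e.+1 | P b') lmon b'%:Z (e%:Z - b'%:Z) *~ c (inr b'))
    (\sum_(b' < e.+1 | P b') (b' == b)%:Z * c (inr b')) by [].
  elim/big_rec2: _ => [|b' t s _ [hs1 hs2]]; first by split; rewrite ?rpred0 ?lcoef0.
  have hb : lmon b'%:Z (e%:Z - b'%:Z) *~ c (inr b') \in sec_xy e%:Z by rewrite rpredMz ?hs.
  split; first by rewrite rpredD.
  rewrite (lcoefD _ _ hb hs1) hs2 (lcoefMz _ _ _ (hs b')) lcoef_lmon.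
  congr (_%:Z * _ + _); congr nat_of_bool; rewrite -val_eqE /=; lia.
have := lsum predT; rewrite [X in _ = X](bigD1 b) //= eqxx mul1r.
rewrite [X in _ = _ + X]big1 ?addr0 => [<-|b' /negPf ->]; last by rewrite mul0r.
rewrite -(_ : 0 = \sum_(b' < e.+1) lmon b'%:Z (e%:Z - b'%:Z) *~ c (inr b')) ?lcoef0 //.
by apply: (etrans (esym E2)); apply: eq_bigr => b' _; rewrite raddfMz.
Qed.

End Classes.

Arguments overlap {n f e}.
Arguments on_x {n f e}.
Arguments on_y {n f e}.

(** * The structure attached to a form *)

(** Here [a0], [a1] are the overlap components and [b0], [b1] the D_+(x)-components of consecutive
    zetas, and [a * uy + b * ua] is the overlap component of a cup product. *)
Lemma slant_cup_id (A : comPzRingType) (x y a0 a1 b0 b1 c ua uy : A) :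
    y * a1 = x * a0 -> y * b1 = x * b0 + x * c ->
  y * (a1 * uy + b1 * ua) = x * (a0 * uy + b0 * ua) + x * ua * c.
Proof.
by move=> Ea Eb; rewrite mulrDr !mulrA Ea Eb; ring.
Qed.

Lemma H0_eq0 n (f : binary_form n) k (u : cocycle f k) :
  is_coboundary u -> \pi_(H0 f k) u = 0.
Proof.
move=> hu; have /H0_eqP -> : is_coboundary (u - 0) by rewrite subr0.
exact: raddf0.
Qed.

Section Model.
Variables (m : nat) (f : binary_form m.+3).
Local Notation n := m.+3.
Local Notation F := ((form_poly f)%:F : Kxy).

Definition form_coef (l : nat) : int := f (inord l).

(** With theta = x/y, the D_+(y)-component is f_0 theta^i + ... + f_(i-1) theta. *)
Definition lift_zeta (i : nat) : form_ring f :=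
  \pi_(H0 f 0%:Z) (lift_cocycle f 0 (i%:Z - n%:Z)).

Definition model_zeta (j : 'I_n) : form_ring f :=
  if j == ord0 then 1 else lift_zeta j.

(** The overlap components are x^(-1) y^(-2) and x^(-2) y^(-1), the monomial basis of H^1(P^1,
    O(-3)). *)
Definition model_alpha (a : 'I_2) : form_module f m%:Z :=
  \pi_(H0 f m%:Z) (lift_cocycle f m (- a.+1%:Z)).

Definition model_beta (k : 'I_m.+1) : form_module f m%:Z :=
  \pi_(H0 f m%:Z) (poly_cocycle f k).

Lemma scale_piE (r : cocycle f 0) (u : cocycle f m%:Z) :
  (\pi_(H0 f 0) r : form_ring f) *: (\pi_(H0 f m%:Z) u : form_module f m%:Z)
    = \pi_(H0 f m%:Z) (cup r u).
Proof. exact: H0actE. Qed.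

(** The overlap component x^(-n) is regular over D_+(x), and all terms of its product with the form
    lie in [lift_x]. *)
Lemma lift_zeta0 : lift_zeta 0 = 0.
Proof.
apply: H0_eq0; apply/coboundaryP; exists (- lmon (- n%:Z) 0), 0; split.
- have -> : 0%:Z - n%:Z = - n%:Z + 0 by ring.
  by rewrite rpredN; exact: lmon_sec_x.
- exact: rpred0.
- by rewrite [RHS]sub0r opprK /=; congr lmon; lia.
- rewrite mulrN form_poly_mul /= /lift_x; congr (- _).
  rewrite [RHS](bigID (fun l : 'I_n.+1 => ~~ (0 < 0%:Z - n%:Z + n%:Z - l%:Z))) /=.
  rewrite [X in _ = _ + X]big1 ?addr0 => [|l]; last by lia.
  by apply: eq_bigr => l _; congr (lmon _ _ *~ _); lia.
- by rewrite mulr0 /= /lift_y big1 // => l; lia.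
Qed.

(** The overlap component y^(-n) is regular over D_+(y), and its product with the form differs from
    [lift_y] exactly by the constant term f_n. *)
Lemma lift_zetan : lift_zeta n = (- form_coef n)%:~R.
Proof.
apply/eqP; rewrite -subr_eq0 mulrNz opprK; apply/eqP.
have -> : lift_zeta n + (form_coef n)%:~R =
    \pi_(H0 f 0%:Z) (lift_cocycle f 0 (n%:Z - n%:Z) + cocycle_one f *~ form_coef n).
  by rewrite raddfD raddfMz.
apply: H0_eq0; apply/coboundaryP; exists 0, (lmon 0 (- n%:Z)); split.
- exact: rpred0.
- have -> : 0%:Z - n%:Z = 0 + - n%:Z by ring.
  exact: lmon_sec_y.
- by rewrite raddfD raddfMz /= mul0rz subr0 addr0; congr lmon; lia.
- rewrite raddfD raddfMz /= mulr0 /lift_x (bigD1 ord_max) /=; last by lia.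
  rewrite big1 ?addr0 => [|l /andP[h1]]; last first.
    by rewrite -val_eqE /=; have := ltn_ord l; lia.
  rewrite /form_coef (_ : inord n = ord_max); last by apply: val_inj; rewrite /= inordK.
  rewrite (_ : lmon _ _ = 1) ?addNr // -lmon00; congr lmon; lia.
rewrite raddfD raddfMz /= form_poly_mul /lift_y.
rewrite [RHS](bigD1 ord_max) //= addrC; congr (_ + _); last first.
  rewrite /form_coef (_ : inord n = ord_max); last by apply: val_inj; rewrite /= inordK.
  congr (_ *~ _); rewrite -lmon00; congr lmon; lia.
apply: eq_big => [l|l _]; last by congr (lmon _ _ *~ _); lia.
by rewrite -val_eqE /=; have := ltn_ord l; lia.
Qed.

Lemma model_zeta_is_Zbasis : is_Zbasis model_zeta.
Proof.
(* [H0_basis] lists the lifts by increasing pole order along x, that is, by decreasing index of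
   zeta; hence [rev_ord]. *)
pose h (j : 'I_n) : 'I_m.+2 + 'I_1 :=
  if unlift ord0 j is Some a then inl (rev_ord a) else inr ord0.
pose g (s : 'I_m.+2 + 'I_1) : 'I_n :=
  match s with inl a => lift ord0 (rev_ord a) | inr _ => ord0 end.
have hK : cancel h g.
  by move=> j; rewrite /h; case: unliftP => [a ->|->] /=; rewrite ?rev_ordK.
have gK : cancel g h.
  case=> [a|b]; rewrite /h /g; first by rewrite liftK rev_ordK.
  by rewrite unlift_none [b]ord1.
have zE : model_zeta = H0_basis f (d := m.+2) \o h.
  apply/funext => j; rewrite /model_zeta /h /=; case: unliftP => [a ->|->] /=.
    have E : (lift ord0 a)%:Z - n%:Z = - (rev_ord a).+1%:Z :> int.
      by move: (ltn_ord a); rewrite lift0 /=; move: (nat_of_ord a) => {}a; clear; lia.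
    by rewrite /lift_zeta E.
  congr (\pi_(H0 f 0%:Z) _); apply: val_inj; rewrite /= /poly_val.
  by rewrite subr0 lmon00.
rewrite zE; apply: is_Zbasis_reindex; first by exists g.
exact: H0_basis_is_Zbasis.
Qed.

Lemma model_module_is_Zbasis : is_Zbasis (sum_family model_alpha model_beta).
Proof.
have -> : sum_family model_alpha model_beta = H0_basis f (d := 2).
  by apply/funext => -[].
by apply: H0_basis_is_Zbasis; lia.
Qed.

Local Notation hc a := (@hcoef_fun m.+3 f m (- a.+1%:Z)).

Lemma hc_range a : (a < 2)%N -> m%:Z - n%:Z < - a.+1%:Z < 0.
Proof. lia. Qed.

Lemma hc_zmod_morphism a : (a < 2)%N -> zmod_morphism (hc a).
Proof. by move=> ha; exact: hcoef_zmod_morphism (hc_range ha). Qed.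

Lemma hc_alpha a (b : 'I_2) : (a < 2)%N -> hc a (model_alpha b) = (a == b).
Proof.
move=> ha; rewrite hcoef_funE ?hc_range // lcoef_lmon.
by congr (nat_of_bool _)%:Z; lia.
Qed.

Lemma hc_beta a (k : 'I_m.+1) : (a < 2)%N -> hc a (model_beta k) = 0.
Proof. by move=> ha; rewrite hcoef_funE ?hc_range // lcoef0. Qed.

(** For positive [j] the overlap component of the product is the single monomial x^(j-n+k)
    y^(m-j-k). *)
Lemma hc_act a (j : 'I_n) (k : 'I_m.+1) : (a < 2)%N ->
  hc a (model_zeta j *: model_beta k) = (a + j + k == m.+2)%N.
Proof.
move=> ha; rewrite /model_zeta; have hk := ltn_ord k; have hj := ltn_ord j.
have [->|j0] := eqVneq j ord0.
  by rewrite scale1r hc_beta //=; lia.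
rewrite scale_piE hcoef_funE ?hc_range // /= mulr0 addr0 lmonM lcoef_lmon.
by congr (nat_of_bool _)%:Z; lia.
Qed.

(** Compare the coefficients of x^(-1) y^(-1) in y zeta_(i+1) w = x zeta_i w + f_i x w on the
    overlap: dividing by y or x turns them into the coefficients read by [hc 0] and [hc 1]. *)
Lemma hc_slant i (w : form_module f m%:Z) : (i < n)%N ->
  hc 0 (lift_zeta i.+1 *: w) = hc 1 (lift_zeta i *: w) + form_coef i * hc 1 w.
Proof.
move=> hi; have [u ->] := H0_surj w.
rewrite !scale_piE !hcoef_funE ?hc_range //.
set u1 := cup _ u; set u0 := cup _ u.
have [h1 _ _ _] := cocycleP u1; have [h0 _ _ _] := cocycleP u0.
have [hu _ _ _] := cocycleP u.
have E : vary%:F * overlap u1 =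
    varx%:F * overlap u0 + varx%:F * overlap u *~ form_coef i :> Kxy.
  rewrite -mulrzr; apply: slant_cup_id; rewrite -lmon_X -lmon_Y.
    by rewrite !lmonM; congr lmon; lia.
  (* The sum in x times the D_+(x)-component of zeta_i has one term more than that in y times the
     component of zeta_(i+1), namely [l = i]. *)
  rewrite mulrzr /lift_x !mulrN [in RHS](bigD1 (inord i)) /=; last by rewrite inordK; lia.
  rewrite !(mulrDr, mulr_sumr) mulrzAr lmonM [X in _ = X + _]opprD.
  rewrite -/(form_coef i) inordK; last by lia.
  have -> : lmon (1 + (i%:Z - n%:Z + n%:Z - i%:Z))
      (0 + (0%:Z - n%:Z - (i%:Z - n%:Z) + i%:Z)) = lmon 1 0 by congr lmon; lia.
  rewrite [RHS]addrAC [X in _ = X + _]addNr [RHS]add0r; congr (- _).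
  apply: eq_big => [l|l _].
    by rewrite -val_eqE /= inordK; lia.
  by rewrite !mulrzAr !lmonM; congr (lmon _ _ *~ _); lia.
have := congr1 (lcoef (-1) (-1)) E.
rewrite (lcoefYM _ _ h1).
have hX s : s \in sec_xy (m%:Z - n%:Z) -> varx%:F * s \in sec_xy (1 + (m%:Z - n%:Z)).
  by apply: sec_xyM; rewrite -lmon_X -[X in sec_xy X](addr0 1); exact: lmon_sec_xy.
rewrite (lcoefD _ _ (hX _ h0)) ?rpredMz ?hX //.
rewrite (lcoefMz _ _ _ (hX _ hu)) !(lcoefXM _ _ h0) (lcoefXM _ _ hu).
have -> : m%:Z - n%:Z - - 1 = -1 - 1 by lia.
have -> : m%:Z - n%:Z - - 2 = -1 by lia.
by rewrite [form_coef i * _]mulrC.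
Qed.

Lemma model_normdata : exists D : normdata m (form_module f m%:Z),
  form_data D form_coef.
Proof.
have [i j k|D [zE aE bE]] :=
    @normdata_of_bases m _ (form_module f m%:Z) _ _ _
      model_zeta_is_Zbasis erefl model_module_is_Zbasis.
  set x := model_zeta j *: model_beta k.
  exists [ffun s => zcoord_fun model_module_is_Zbasis s x].
    by rewrite {1}[x](zcoord_sum model_module_is_Zbasis); apply: eq_bigr => s _; rewrite ffunE.
  have [h hE] : exists h : {additive H0 f m%:Z -> int}, forall x, h x = hc i x.
    by exists (HB.pack_for {additive H0 f m%:Z -> int} (hc i)
      (GRing.isZmodMorphism.Build _ _ _ (hc_zmod_morphism (ltn_ord i)))).
  have := hE x; rewrite hc_act // [in LHS](zcoord_sum model_module_is_Zbasis x).
  rewrite big_sumType raddfD !raddf_sum /= (bigD1 i) //= raddfMz hE hc_alpha // eqxx.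
  rewrite mulrzz mul1r big1 ?addr0 => [|i' /negPf i'i]; last first.
    by rewrite raddfMz hE hc_alpha // [_ == _]eq_sym (_ : (i' == i :> nat) = false) ?mul0rz.
  rewrite big1 ?addr0 => [|k' _]; last by rewrite raddfMz hE hc_beta // mul0rz.
  rewrite ffunE => ->.
  have -> : (i.+1 + j + k.+1 == m.+4)%N = (i + j + k == m.+2)%N by lia.
  by case: eqP.
(* Both functionals are dual to the same [alpha] and kill the [beta]. This transfers [hc_slant] to
   [qco], which the later change of [alp] preserves. *)
have qE a : (a < 2)%N -> qco D a =1 hc a.
  move=> ha; apply: (eq_on_bases (D := D)) => [x y|x y|b hb|k hk].
  - exact: raddfB.
  - exact: hc_zmod_morphism.
  - by rewrite qco_alp // -[b]/(nat_of_ord (Ordinal hb)) aE hc_alpha.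
  - by rewrite qco_bet // -[k]/(nat_of_ord (Ordinal hk)) bE hc_beta.
have [D' [zE' qE' bE' aE']] := change_alp D.
exists D'; split=> [i w hi|b hb]; last by rewrite aE' zE' bE'.
(* The end values agree by [lift_zeta0] and [lift_zetan]. *)
have extE j : (j <= n)%N -> ext_zeta D' form_coef j = lift_zeta j.
  move=> hj; rewrite /ext_zeta zE'; case: eqP => [->|/eqP j0]; first by rewrite lift_zeta0.
  case: eqP => [->|/eqP jn]; first by rewrite lift_zetan.
  have hj' : (j < n)%N by lia.
  by rewrite -[j]/(nat_of_ord (Ordinal hj')) zE /model_zeta -val_eqE /= (negPf j0).
by rewrite qE' !qE // !extE ?hc_slant //; exact: ltnW.
Qed.

End Model.

(** * Symmetric tensors and symmetric powers *)

Section Words.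
Variable m : nat.
Implicit Types w : m.-tuple 'I_2.

Definition ones w : nat := (\sum_(i < m) tnth w i)%N.

Lemma ones_le w : (ones w <= m)%N.
Proof.
rewrite -[X in (_ <= X)%N]card_ord -sum1_card; apply: leq_sum => i _.
by have := ltn_ord (tnth w i); rewrite ltnS.
Qed.

Lemma ones_word_perm (s : 'S_m) w : ones (word_perm s w) = ones w.
Proof.
rewrite /ones [RHS](reindex_perm s); apply: eq_bigr => i _.
by rewrite tnth_mktuple.
Qed.

Lemma onesE w : ones w = count_mem ord_max w.
Proof.
rewrite -sum1_count big_mkcond big_tuple /=; apply: eq_bigr => i _.
by case: (tnth w i) => [[|[|]]].
Qed.

Lemma ones_eq w w' : ones w = ones w' -> exists s : 'S_m, w = word_perm s w'.
Proof.
move=> E; have /tuple_permP[s Es] : perm_eq w w'.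
  have E1 := E; rewrite !onesE in E1.
  have E0 : count_mem ord0 w = count_mem ord0 w'.
    have cnt0 v : (count_mem ord0 v + count_mem (ord_max : 'I_2) v)%N = size v.
      by elim: v => //= -[[|[|]]] //= hx v IH; rewrite -IH; lia.
    by have := cnt0 w; have := cnt0 w'; rewrite E1 !size_tuple; lia.
  rewrite /perm_eq; apply/allP => -[[|[|]]] // hx _ /=; apply/eqP.
    by rewrite -(_ : ord0 = Ordinal hx) //; apply: val_inj.
  by rewrite -(_ : ord_max = Ordinal hx) //; apply: val_inj.
by exists s; exact: val_inj.
Qed.

Definition word_of (p : nat) : m.-tuple 'I_2 :=
  [tuple (if (i < p)%N then ord_max else ord0) | i < m].

Lemma ones_word_of p : (p <= m)%N -> ones (word_of p) = p.
Proof.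
move=> pm; rewrite -[RHS]card_ord -sum1_card (big_ord_widen m (fun=> 1%N) pm).
rewrite [RHS]big_mkcond /ones; apply: eq_bigr => i _.
by rewrite tnth_mktuple; case: ifP.
Qed.

End Words.

Lemma ones_cons m i (w : m.-tuple 'I_2) : ones (cons_tuple i w) = (i + ones w)%N.
Proof.
rewrite /ones big_ord_recl tnth0; congr (_ + _)%N.
by apply: eq_bigr => j _; rewrite tnthS.
Qed.

Section SymmetricTensors.
Variable m : nat.

Lemma sym_tensor_ones (t : sym_tensor m) w w' :
  ones w = ones w' -> (t : tensor m) w = (t : tensor m) w'.
Proof.
move=> /ones_eq[s ->]; case: t => t /= /forallP/(_ s)/eqP/ffunP/(_ w').
by rewrite ffunE.
Qed.

Lemma ones_tensor_symmetric (g : nat -> int) :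
  is_symmetric ([ffun w => g (ones w)] : tensor m).
Proof.
by apply/forallP => s; apply/eqP/ffunP => w; rewrite !ffunE ones_word_perm.
Qed.

Definition ones_tensor g : sym_tensor m := SymTensor (ones_tensor_symmetric g).

Lemma ones_tensorE g w : (ones_tensor g : tensor m) w = g (ones w).
Proof. by rewrite ffunE. Qed.

Lemma sym_tensorP (t u : sym_tensor m) :
  (forall p, (p <= m)%N -> (t : tensor m) (word_of m p) = (u : tensor m) (word_of m p)) ->
  t = u.
Proof.
move=> tu; apply: val_inj; apply/ffunP => w.
have Ew : ones w = ones (word_of m (ones w)) by rewrite ones_word_of // ones_le.
by rewrite /= (sym_tensor_ones t Ew) (sym_tensor_ones u Ew) tu // ones_le.
Qed.

Lemma tensor_coef_zmod_morphism p :
  zmod_morphism (fun t : sym_tensor m => (t : tensor m) (word_of m p)).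
Proof. by move=> t u; rewrite -[sym_tensor_val (t - u)]/(val (t - u)) raddfB !ffunE. Qed.

Definition tensor_coef p : {additive sym_tensor m -> int} := HB.pack_for
  {additive sym_tensor m -> int} (fun t : sym_tensor m => (t : tensor m) (word_of m p))
  (GRing.isZmodMorphism.Build _ _ _ (tensor_coef_zmod_morphism p)).

Lemma tensor_coef_ones p g : (p <= m)%N -> tensor_coef p (ones_tensor g) = g p.
Proof. by move=> hp; rewrite /= ffunE ones_word_of. Qed.

(** This is the coefficient of e_0^(m-k) e_1^k in the image of [u] in Sym^m V. *)
Definition ones_sum k (u : tensor m) : int := \sum_(w | ones w == k) u w.

Lemma ones_sum_zmod_morphism k : zmod_morphism (ones_sum k).
Proof.
by move=> u v; rewrite -sumrB; apply: eq_bigr => w _; rewrite !ffunE.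
Qed.

HB.instance Definition _ k := GRing.isZmodMorphism.Build (tensor m) int (ones_sum k)
  (ones_sum_zmod_morphism k).

Lemma ones_sum_perm k s u : ones_sum k (tensor_perm s u) = ones_sum k u.
Proof.
rewrite /ones_sum [RHS](reindex (word_perm s)) /=; last exact: onW_bij (word_perm_bij s).
by apply: eq_big => [w|w _]; rewrite ?ones_word_perm ?ffunE.
Qed.

Lemma ones_sum_relation k u : is_sym_relation u -> ones_sum k u = 0.
Proof.
move=> /asboolP[c ->]; rewrite raddf_sum big1 // => s _.
by rewrite raddfB /= ones_sum_perm subrr.
Qed.

Lemma sym_powerP (u v : tensor m) :
  is_sym_relation (u - v) <-> \pi_(sym_power m) u = \pi_(sym_power m) v.
Proof.
split=> [h|/eqP].
  by apply/eqP; rewrite -(Quotient.idealrBE (sym_relations m)).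
by rewrite -(Quotient.idealrBE (sym_relations m)).
Qed.

Lemma sym_power_pi_zmod_morphism : zmod_morphism (\pi_(sym_power m) : tensor m -> sym_power m).
Proof. exact: (pi_is_zmod_morphism (Quotient.quot (sym_relations m))). Qed.

HB.instance Definition _ := GRing.isZmodMorphism.Build (tensor m) (sym_power m)
  (\pi_(sym_power m)) sym_power_pi_zmod_morphism.

Definition power_coord_fun k (x : sym_power m) : int := ones_sum k (repr x).

Lemma power_coord_funE k u : power_coord_fun k (\pi_(sym_power m) u) = ones_sum k u.
Proof.
apply/eqP; rewrite -subr_eq0 -raddfB /=; apply/eqP/ones_sum_relation.
by apply/sym_powerP; rewrite reprK.
Qed.

Lemma sym_power_surj (x : sym_power m) : exists u, x = \pi_(sym_power m) u.
Proof. by exists (repr x); rewrite reprK. Qed.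

Lemma power_coord_zmod_morphism k : zmod_morphism (power_coord_fun k).
Proof.
move=> x y; have [u ->] := sym_power_surj x; have [v ->] := sym_power_surj y.
by rewrite -raddfB !power_coord_funE raddfB.
Qed.

Definition power_coord k : {additive sym_power m -> int} := HB.pack_for
  {additive sym_power m -> int} (power_coord_fun k)
  (GRing.isZmodMorphism.Build _ _ _ (power_coord_zmod_morphism k)).

Definition word_tensor w : tensor m := [ffun w' => (w' == w)%:Z].

Definition monomial k : sym_power m := \pi_(sym_power m) (word_tensor (word_of m k)).

Lemma power_coord_monomial k l : (l <= m)%N -> power_coord k (monomial l) = (k == l).
Proof.
move=> hl; rewrite /= power_coord_funE /ones_sum.
have [<-|kl] := eqVneq l k.
  rewrite (bigD1 (word_of m l)) /= ?ones_word_of // ffunE eqxx big1 ?addr0 // => w.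
  by case/andP=> _ /negPf wl; rewrite ffunE wl.
rewrite big1 // => w wk; rewrite ffunE; case: eqP => // Ew.
by rewrite Ew ones_word_of // (negPf kl) in wk.
Qed.

Lemma word_tensor_ones w w' : ones w = ones w' ->
  \pi_(sym_power m) (word_tensor w) = \pi_(sym_power m) (word_tensor w').
Proof.
move=> /ones_eq[s ->]; apply/sym_powerP/asboolP.
exists (fun s' => if s' == s then word_tensor (word_perm s w') else 0).
rewrite (bigD1 s) //= eqxx big1 ?addr0 => [|s' /negPf ->]; last by rewrite raddf0 subrr.
congr (_ - _); apply/ffunP => v; rewrite !ffunE.
by rewrite (bij_eq (word_perm_bij s)).
Qed.

Lemma monomial_sum (x : sym_power m) :
  x = \sum_(k < m.+1) monomial k *~ power_coord k x.
Proof.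
have [u ->] := sym_power_surj x.
have {1}-> : u = \sum_w word_tensor w *~ u w.
  apply/ffunP => w; rewrite sum_ffunE (bigD1 w) //= ffunMzE ffunE eqxx intz.
  rewrite big1 ?addr0 // => w' /negPf w'w.
  by rewrite ffunMzE ffunE eq_sym w'w mul0rz.
rewrite raddf_sum.
have le_ones w : (@ones m w < m.+1)%N by rewrite ltnS ones_le.
rewrite (partition_big (fun w => Ordinal (le_ones w)) predT) //=.
apply: eq_bigr => k _; rewrite power_coord_funE /ones_sum mulrz_sumr.
apply: eq_big => [w|w /eqP <-]; first by rewrite -val_eqE.
rewrite raddfMz; congr (_ *~ _); apply: word_tensor_ones => /=.
by rewrite ones_word_of // ones_le.
Qed.

End SymmetricTensors.

Arguments power_coord {m} k.
Arguments tensor_coef {m} p.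
Arguments power_coord_fun {m} k x.

Definition dual_comb (c : nat -> int) : V2dual := \sum_(i < 2) c i *: dual_basis i.

Lemma dual_comb_coef c (i : 'I_2) : dual_comb c (delta_mx 0 i) = c i.
Proof.
rewrite /dual_comb sum_lfunE (bigD1 i) //= scale_lfunE dual_basisE mxE !eqxx.
rewrite big1 ?addr0 => [|j /negPf ji]; first exact: mulr1.
by rewrite scale_lfunE dual_basisE mxE ji andbF; exact: mulr0.
Qed.

Lemma dual_combE (l : V2dual) (c : nat -> int) :
  (forall i : 'I_2, c i = l (delta_mx 0 i)) -> l = dual_comb c.
Proof.
move=> cE; apply/lfunP => v; rewrite dual_expand [RHS]dual_expand.
by apply: eq_bigr => i _; rewrite dual_comb_coef cE.
Qed.

Lemma dual_comb_inj c c' (i : 'I_2) : dual_comb c = dual_comb c' -> c i = c' i.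
Proof. by move=> E; rewrite -!dual_comb_coef E. Qed.

(** If [w] contains [k] ones, then [cons_tuple i w] contains [i + k]. Grouping the words by their
    number of ones turns the contraction into a Hankel pairing. *)
Lemma natural_map_monomial m (g : nat -> int) (x : sym_power m) :
  natural_map (ones_tensor m.+1 g) x
    = dual_comb (fun i => \sum_(k < m.+1) g (i + k)%N * power_coord k x).
Proof.
have [u ->] := sym_power_surj x; rewrite natural_mapE; apply: eq_bigr => i _.
congr (_ *: _).
have le_ones w : (@ones m w < m.+1)%N by rewrite ltnS ones_le.
rewrite (partition_big (fun w => Ordinal (le_ones w)) predT) //=.
apply: eq_bigr => k _; rewrite power_coord_funE /ones_sum mulr_sumr.
apply: eq_big => [w|w /eqP <-]; first by rewrite -val_eqE.
by rewrite ffunE ones_cons.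
Qed.

(** * Comparison with normalized bases *)

Section ModIntegers.
Variable R : comPzRingType.

Lemma mod_Z_surj (x : mod_Z R) : exists r, x = \pi_(mod_Z R) r.
Proof. by exists (repr x); rewrite reprK. Qed.

Lemma mod_ZP (r s : R) :
  (exists c : int, r - s = c%:~R) <-> \pi_(mod_Z R) r = \pi_(mod_Z R) s.
Proof.
split=> [h|/eqP].
  apply/eqP; rewrite -(Quotient.idealrBE (integers R)); exact/asboolP.
by rewrite -(Quotient.idealrBE (integers R)) => /asboolP.
Qed.

Lemma mod_Z_pi_zmod_morphism : zmod_morphism (\pi_(mod_Z R) : R -> mod_Z R).
Proof. exact: (pi_is_zmod_morphism (Quotient.quot (integers R))). Qed.

HB.instance Definition _ := GRing.isZmodMorphism.Build R (mod_Z R)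
  (\pi_(mod_Z R)) mod_Z_pi_zmod_morphism.

Lemma mod_Z_int (c : int) : \pi_(mod_Z R) c%:~R = 0.
Proof. by rewrite -[RHS](raddf0 (\pi_(mod_Z R))); apply/mod_ZP; exists c; rewrite subr0. Qed.

End ModIntegers.

Section SymmetricOfNormdata.
Variables (m : nat) (R : comPzRingType) (I : lmodType R) (D : normdata m I).
Local Notation z := (zet D).
Local Notation al := (alp D).
Local Notation be := (bet D).
Local Notation rc := (rco D).
Local Notation qc := (qco D).
Local Notation bc := (bco D).

(** The index [m.+2 - p] matches [qco_scale_bet] with [p = a + k]. Since [p] is at most [m.+1], the
    coordinate at [z 0] is never read and the tensor depends only on the class modulo the
    integers. *)
Definition tensor_of_mod_Z (x : mod_Z R) : sym_tensor m.+1 :=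
  ones_tensor m.+1 (fun p => rc (m.+2 - p)%N (repr x)).

Lemma tensor_of_mod_ZE r :
  tensor_of_mod_Z (\pi_(mod_Z R) r) = ones_tensor m.+1 (fun p => rc (m.+2 - p)%N r).
Proof.
set x := \pi_(mod_Z R) r.
have [c Ec] : exists c : int, repr x - r = c%:~R by apply/mod_ZP; rewrite reprK.
apply: sym_tensorP => p hp; rewrite !ones_tensorE ones_word_of //.
apply/eqP; rewrite -subr_eq0 -raddfB Ec rco_int //; lia.
Qed.

Lemma tensor_of_mod_Z_zmod_morphism : zmod_morphism tensor_of_mod_Z.
Proof.
move=> x y; have [r ->] := mod_Z_surj x; have [s ->] := mod_Z_surj y.
rewrite -raddfB !tensor_of_mod_ZE; apply: val_inj; apply/ffunP => w.
by rewrite raddfB /= !ffunE raddfB.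
Qed.

Definition mod_Z_of_tensor (t : sym_tensor m.+1) : mod_Z R :=
  \pi_(mod_Z R) (\sum_(j < m.+2) z j.+1 *~ (t : tensor m.+1) (word_of m.+1 (m.+1 - j))).

Lemma tensor_of_mod_ZK : cancel tensor_of_mod_Z mod_Z_of_tensor.
Proof.
move=> x; have [r ->] := mod_Z_surj x; rewrite tensor_of_mod_ZE.
apply/esym/mod_ZP; exists (rc 0%N r).
rewrite {1}[r](rco_sum D) big_ord_recl /= zet0; apply/eqP.
rewrite subr_eq; apply/eqP; congr (_ + _); apply: eq_bigr => j _.
rewrite ffunE ones_word_of; last by lia.
by congr (z _ *~ rc _ r); rewrite /bump leq0n; have := ltn_ord j; lia.
Qed.

Lemma mod_Z_of_tensorK : cancel mod_Z_of_tensor tensor_of_mod_Z.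
Proof.
move=> t; rewrite /mod_Z_of_tensor tensor_of_mod_ZE; apply: sym_tensorP => p hp.
rewrite ones_tensorE ones_word_of // raddf_sum.
pose G j := (t : tensor m.+1) (word_of m.+1 (m.+1 - j)).
rewrite -[RHS](_ : G (m.+1 - p)%N = _); last by rewrite /G; congr (_ (word_of _ _)); lia.
rewrite -(@sum_delta m.+2 (m.+1 - p) G); last by lia.
apply: eq_bigr => j _; have hj := ltn_ord j.
rewrite raddfMz rco_zet; [|lia|lia].
rewrite mulrzz /G; congr (_%:Z * _); congr nat_of_bool; lia.
Qed.

Definition inject_power (k : sym_power m) : I := \sum_(l < m.+1) be l *~ power_coord l k.

Lemma inject_power_zmod_morphism : zmod_morphism inject_power.
Proof.
by move=> x y; rewrite -sumrB; apply: eq_bigr => l _; rewrite raddfB mulrzBr.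
Qed.

Lemma bco_inject_power l k : (l < m.+1)%N -> bc l (inject_power k) = power_coord l k.
Proof.
move=> hl; rewrite raddf_sum -(@sum_delta m.+1 l (fun l => power_coord l k)) //.
by apply: eq_bigr => j _; rewrite raddfMz bco_bet // mulrzz.
Qed.

Lemma inject_power_inj : injective inject_power.
Proof.
move=> x y E; rewrite (monomial_sum x) (monomial_sum y); apply: eq_bigr => l _.
by rewrite -!bco_inject_power // E.
Qed.

Lemma qco_inject_power a r k : (a < 2)%N ->
  qc a (r *: inject_power k) = \sum_(l < m.+1) rc (m.+2 - a - l)%N r * power_coord l k.
Proof.
move=> ha; rewrite scaler_sumr raddf_sum; apply: eq_bigr => l _.
by rewrite -scalerMzr raddfMz qco_scale_bet // mulrzz.
Qed.

Definition dual_quotient (x : I) : V2dual := dual_comb (fun i => qc i x).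

Lemma dual_quotient_zmod_morphism : zmod_morphism dual_quotient.
Proof.
by move=> x y; rewrite -sumrB; apply: eq_bigr => i _; rewrite raddfB scalerBl.
Qed.

Lemma dual_comb0 : dual_comb (fun=> 0) = 0.
Proof. by rewrite /dual_comb big1 // => i _; rewrite scale0r. Qed.

Lemma dual_quotient_eq0 x : dual_quotient x = 0 <-> exists k, x = inject_power k.
Proof.
split=> [|[k ->]].
  rewrite -dual_comb0 => E.
  have q0 a : (a < 2)%N -> qc a x = 0.
    by move=> ha; exact: (dual_comb_inj (Ordinal ha) E).
  exists (\sum_(l < m.+1) monomial m l *~ bc l x).
  rewrite {1}[x](ico_sum D) big1 ?add0r => [|a _]; last by rewrite q0 // mulr0z.
  apply: eq_bigr => l _; congr (_ *~ _).
  rewrite raddf_sum -(@sum_delta m.+1 l (fun l => bc l x)) //.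
  apply: eq_bigr => k _; rewrite raddfMz power_coord_monomial; last first.
    by rewrite -ltnS.
  by rewrite mulrzz.
rewrite -dual_comb0 /dual_quotient; apply: eq_bigr => i _; congr (_ *: _).
by rewrite raddf_sum big1 // => l _; rewrite raddfMz qco_bet // mul0rz.
Qed.

Lemma dual_quotient_surj l : exists x, dual_quotient x = l.
Proof.
pose c (i : nat) := l (delta_mx 0 (inord i)).
exists (\sum_(a < 2) al a *~ c a); apply/esym/dual_combE => i.
rewrite raddf_sum -[RHS](_ : c i = _); last by rewrite /c inord_val.
rewrite -(@sum_delta 2 i c) //.
by apply: eq_bigr => a _; rewrite raddfMz qco_alp // mulrzz.
Qed.

Lemma symmetric_structure_of_normdata : symmetric_structure m.+3 I.
Proof.
rewrite /symmetric_structure; have -> : (m.+3 - 3 = m)%N by lia.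
exists (HB.pack_for {additive mod_Z R -> sym_tensor m.+1} tensor_of_mod_Z
  (GRing.isZmodMorphism.Build _ _ _ tensor_of_mod_Z_zmod_morphism)).
exists (HB.pack_for {additive sym_power m -> I} inject_power
  (GRing.isZmodMorphism.Build _ _ _ inject_power_zmod_morphism)).
exists (HB.pack_for {additive I -> V2dual} dual_quotient
  (GRing.isZmodMorphism.Build _ _ _ dual_quotient_zmod_morphism)).
split=> /=.
- by exists mod_Z_of_tensor; [exact: tensor_of_mod_ZK | exact: mod_Z_of_tensorK].
- exact: inject_power_inj.
- exact: dual_quotient_eq0.
- exact: dual_quotient_surj.
move=> r k; rewrite tensor_of_mod_ZE natural_map_monomial /dual_quotient.
apply: eq_bigr => i _; congr (_ *: _); rewrite qco_inject_power //.
by apply: eq_bigr => l _; rewrite subnDA.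
Qed.

End SymmetricOfNormdata.

Section BasesOfSymmetric.
Variables (m : nat) (R : comPzRingType) (I : lmodType R).
Variables (phi : {additive mod_Z R -> sym_tensor m.+1}).
Variables (iota : {additive sym_power m -> I}) (q : {additive I -> V2dual}).
Hypotheses (phi_bij : bijective phi) (iota_inj : injective iota).
Hypothesis q_ker : forall x : I, q x = 0 <-> exists k, x = iota k.
Hypothesis q_surj : forall l : V2dual, exists x : I, q x = l.
Hypothesis q_act : forall r k, q (r *: iota k) = natural_map (phi (\pi_(mod_Z R) r)) k.

Local Notation zeta_tensor j := (ones_tensor m.+1 (fun p => (m.+2 - p == j)%N%:Z)).

(** For [j = 0] the tensor is zero, because words of length [m.+1] have at most [m.+1] ones; so 1 is
    a valid lift. *)
Lemma exists_zeta (j : nat) : exists r : R,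
  (j = 0%N -> r = 1) /\ phi (\pi_(mod_Z R) r) = zeta_tensor j.
Proof.
have [g phiK gK] := phi_bij.
case: j => [|j]; last by exists (repr (g (zeta_tensor j.+1))); rewrite reprK gK.
exists 1; split=> //; rewrite -[1]/(1%:~R) mod_Z_int raddf0.
apply: sym_tensorP => p hp; rewrite ones_tensorE ones_word_of //.
by rewrite -[LHS]/(tensor_coef p 0) raddf0; lia.
Qed.

Definition sym_zeta (j : 'I_m.+3) : R := sval (cid (exists_zeta j)).
Definition sym_beta (k : 'I_m.+1) : I := iota (monomial m k).
Definition sym_alpha (i : 'I_2) : I := sval (cid (q_surj (dual_basis i))).

Lemma sym_zeta0 : sym_zeta ord0 = 1.
Proof. by have [h _] := svalP (cid (exists_zeta (ord0 : 'I_m.+3))); exact: h. Qed.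

Lemma sym_zetaE (j : 'I_m.+3) : phi (\pi_(mod_Z R) (sym_zeta j)) = zeta_tensor j.
Proof. by have [_ h] := svalP (cid (exists_zeta j)). Qed.

Lemma q_sym_alpha i : q (sym_alpha i) = dual_basis i.
Proof. exact: svalP (cid (q_surj (dual_basis i))). Qed.

Lemma q_iota k : q (iota k) = 0.
Proof. by apply/q_ker; exists k. Qed.

Lemma tensor_coef_comb (c : nat -> int) p : (p <= m.+1)%N ->
  tensor_coef p (phi (\pi_(mod_Z R) (\sum_(j < m.+3) sym_zeta j *~ c j))) = c (m.+2 - p)%N.
Proof.
move=> hp; rewrite !raddf_sum -(@sum_delta m.+3 (m.+2 - p) c); last by lia.
apply: eq_bigr => j _; rewrite !raddfMz sym_zetaE tensor_coef_ones // mulrzz.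
by [].
Qed.

Lemma sym_zeta_is_Zbasis : is_Zbasis sym_zeta.
Proof.
apply: is_Zbasis_free => [r|c].
  pose t := phi (\pi_(mod_Z R) r).
  pose c (j : nat) : int := if j == 0%N then 0 else tensor_coef (m.+2 - j)%N t.
  have E : \pi_(mod_Z R) r = \pi_(mod_Z R) (\sum_(j < m.+3) sym_zeta j *~ c j).
    apply: (bij_inj phi_bij); apply: sym_tensorP => p hp.
    transitivity (tensor_coef p (phi (\pi_(mod_Z R) (\sum_(j < m.+3) sym_zeta j *~ c j)))).
      rewrite tensor_coef_comb // /c (_ : (_ == 0%N) = false); last by lia.
      by rewrite (_ : (m.+2 - (m.+2 - p) = p)%N) //; lia.
    by [].
  have [c0 Ec0] := (mod_ZP _ _).2 E.
  exists (fun j : 'I_m.+3 => if j == ord0 then c0 else c j).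
  rewrite big_ord_recl /= sym_zeta0 -Ec0 big_ord_recl /= mulr0z add0r.
  by rewrite subrK.
move=> E.
have cE (j : 'I_m.+3) : j != ord0 -> c j = 0.
  move=> j0; have hj := ltn_ord j; rewrite -val_eqE /= in j0.
  have := @tensor_coef_comb (fun j => c (inord j)) (m.+2 - j)%N.
  under eq_bigr => i _ do rewrite inord_val.
  rewrite E !raddf0 (_ : (m.+2 - (m.+2 - j) = j)%N); last by lia.
  rewrite inord_val => -> //; lia.
move: E; rewrite big_ord_recl big1 ?addr0 => [|j _]; last by rewrite cE ?mulr0z.
rewrite sym_zeta0 => E j; have [->|] := eqVneq j ord0; last exact: cE.
(* That a nonzero integer is nonzero in [R] is seen on the module: it would otherwise kill
   [iota (monomial m 0)], although [iota] is injective and the monomials are free. *)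
have : iota (monomial m 0 *~ c ord0) = iota 0.
  by rewrite raddfMz raddf0 -scaler_int E scale0r.
move=> /iota_inj/(congr1 (power_coord 0%N)).
by rewrite raddf0 raddfMz power_coord_monomial // mulrzz mul1r.
Qed.

Lemma q_comb (c : 'I_2 + 'I_m.+1 -> int) (i : 'I_2) :
  q (\sum_s sum_family sym_alpha sym_beta s *~ c s) (delta_mx 0 i) = c (inl i).
Proof.
set x := \sum_s _.
have -> : q x = dual_comb (fun j => c (inl (inord j))).
  rewrite /x big_sumType raddfD !raddf_sum /= [X in _ + X]big1 ?addr0 => [|k _]; last first.
    by rewrite raddfMz q_iota mul0rz.
  by apply: eq_bigr => j _; rewrite raddfMz q_sym_alpha inord_val -scaler_int intz.
by rewrite dual_comb_coef inord_val.
Qed.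

(** The exact sequence splits, its quotient being free: the [sym_beta] form a basis of the kernel of
    [q], and the [sym_alpha] lift a basis of the quotient. *)
Lemma sym_module_is_Zbasis : is_Zbasis (sum_family sym_alpha sym_beta).
Proof.
apply: is_Zbasis_free => [x|c E].
  pose c (s : 'I_2 + 'I_m.+1) : int := if s is inl i then q x (delta_mx 0 i) else 0.
  pose y := \sum_s sum_family sym_alpha sym_beta s *~ c s.
  have /q_ker[k Ek] : q (x - y) = 0.
    rewrite raddfB; apply/eqP; rewrite subr_eq0; apply/eqP.
    rewrite (dual_combE (l := q x) (c := fun j => q x (delta_mx 0 (inord j)))); last first.
      by move=> i; rewrite inord_val.
    by apply/esym/dual_combE => i; rewrite q_comb inord_val.
  exists (fun s => if s is inr l then power_coord l k else c s).
  rewrite -[x](subrK y) Ek addrC /y !big_sumType /=.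
  rewrite [X in _ + X + _]big1 ?addr0 //; congr (_ + _).
  rewrite {1}(monomial_sum k) raddf_sum; apply: eq_bigr => l _.
  by rewrite raddfMz.
have c0 i : c (inl i) = 0.
  by rewrite -q_comb E raddf0 zero_lfunE.
case=> [i|l]; first exact: c0.
move: E; rewrite big_sumType /= big1 ?add0r => [E|i _]; last by rewrite c0 mulr0z.
have : iota (\sum_(k < m.+1) monomial m k *~ c (inr k)) = iota 0.
  by rewrite raddf0 -E raddf_sum; apply: eq_bigr => k _; rewrite raddfMz.
move=> /iota_inj/(congr1 (power_coord l)); rewrite raddf0 raddf_sum.
rewrite (bigD1 l) // raddfMz power_coord_monomial -1?ltnS // eqxx mulrzz mul1r.
rewrite big1 ?addr0 => [|k /negPf kl]; first by rewrite [LHS]addr0.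
by rewrite raddfMz power_coord_monomial -1?ltnS // eq_sym [_ == _]kl mul0rz.
Qed.

Lemma normalized_bases_of_sym : normalized_bases m.+3 I.
Proof.
exists sym_zeta, sym_alpha, sym_beta; split.
- exact: sym_zeta_is_Zbasis.
- by move=> j j0; rewrite -sym_zeta0; congr sym_zeta; apply: val_inj.
- exact: sym_module_is_Zbasis.
move=> i j k; have [c [Ec _]] := sym_module_is_Zbasis (sym_zeta j *: sym_beta k).
(* The wanted coefficient is a coordinate of [q] on the product, and [q_act] computes it by the
   natural map. *)
exists c => //; rewrite -q_comb -Ec q_act sym_zetaE natural_map_monomial dual_comb_coef.
have hk : (k < m.+1)%N := ltn_ord k; have hi := ltn_ord i; have hj := ltn_ord j.
transitivity (m.+2 - (i + k) == j)%N%:Z; last first.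
  have -> : (i.+1 + j + k.+1 == m.+4)%N = (m.+2 - (i + k) == j)%N by lia.
  by case: eqP.
rewrite -(@sum_delta m.+1 k (fun l => (m.+2 - (i + l) == j)%N%:Z)) //.
apply: eq_bigr => l _; rewrite power_coord_monomial -1?ltnS // mulrC.
by rewrite [(k == l :> nat)%N]eq_sym.
Qed.

End BasesOfSymmetric.

Lemma normalized_bases_of_symmetric m (R : comPzRingType) (I : lmodType R) :
  symmetric_structure m.+3 I -> normalized_bases m.+3 I.
Proof.
rewrite /symmetric_structure; have -> : (m.+3 - 3 = m)%N by lia.
move=> [phi [iota [q [phi_bij iota_inj q_ker q_surj q_act]]]].
exact: normalized_bases_of_sym phi_bij iota_inj q_ker q_surj q_act.
Qed.

(** * Transport along isomorphisms *)

Lemma normalized_bases_iso n (R R' : comPzRingType) (I : lmodType R) (I' : lmodType R')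
    (phi : {rmorphism R -> R'}) (psi : {additive I -> I'}) :
    bijective phi -> bijective psi -> (forall r v, psi (r *: v) = phi r *: psi v) ->
  normalized_bases n I' -> normalized_bases n I.
Proof.
move=> phi_bij psi_bij psiZ [z [a [b [zB z0 abB act]]]].
have [phi' phiK phi'K] := phi_bij; have [psi' psiK psi'K] := psi_bij.
have psi'_ab s : psi (sum_family (psi' \o a) (psi' \o b) s) = sum_family a b s.
  by case: s => j /=; rewrite psi'K.
exists (phi' \o z), (psi' \o a), (psi' \o b); split.
- apply: (is_Zbasis_pullback (g := phi)) zB => [|j]; first exact: bij_inj.
  exact: phi'K.
- by move=> j /z0 /= ->; rewrite -(rmorph1 phi) phiK.
- exact: is_Zbasis_pullback (bij_inj psi_bij) psi'_ab abB.
move=> i j k; have [c Ec ci] := act i j k; exists c => //.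
apply: (bij_inj psi_bij); rewrite psiZ /= phi'K psi'K Ec raddf_sum.
by apply: eq_bigr => s _; rewrite raddfMz psi'_ab.
Qed.

Lemma form_data_ext m (R : comPzRingType) (I : lmodType R) (D : normdata m I) f f' :
  (forall i, (i <= m.+3)%N -> f i = f' i) -> form_data D f -> form_data D f'.
Proof.
move=> ff' [hs ha]; split=> // i w hi; have := hs i w hi.
by rewrite /ext_zeta !ff' // ltnW.
Qed.

Lemma normalized_bases_of_form m (R : comPzRingType) (I : lmodType R) :
  associated_to_form m.+3 I -> normalized_bases m.+3 I.
Proof.
rewrite /associated_to_form.
have -> : (m.+3)%:Z - 3 = m%:Z by lia.
move=> [f [phi [psi [phi_bij psi_bij psiZ]]]].
have [D _] := model_normdata f.
exact: normalized_bases_iso phi_bij psi_bij psiZ (bases_of_normdata D).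
Qed.

(** The given structure and the Cech model of the form extracted from it satisfy [form_data] for the
    same coefficients, so [form_data_iso] identifies them. *)
Lemma form_of_normalized_bases m (R : comPzRingType) (I : lmodType R) :
  normalized_bases m.+3 I -> associated_to_form m.+3 I.
Proof.
move=> [z [a [b [zB z0 abB act]]]]; rewrite /associated_to_form.
have -> : (m.+3)%:Z - 3 = m%:Z by lia.
have [D0 _] := normdata_of_bases zB (z0 ord0 erefl) abB act.
have [D [f Df]] := exists_form_data D0.
pose bf : binary_form m.+3 := [ffun i : 'I_m.+4 => f i].
have [D' D'f] := model_normdata bf.
have Dbf : form_data D (form_coef bf).
  by apply: form_data_ext Df => i hi; rewrite /form_coef ffunE inordK.
have [phi [psi iso]] := form_data_iso Dbf D'f.
by exists bf, phi, psi.
Qed.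

Lemma symmetric_of_normalized_bases m (R : comPzRingType) (I : lmodType R) :
  normalized_bases m.+3 I -> symmetric_structure m.+3 I.
Proof.
move=> [z [a [b [zB z0 abB act]]]].
have [D _] := normdata_of_bases zB (z0 ord0 erefl) abB act.
exact: symmetric_structure_of_normdata D.
Qed.

Theorem theorem1p1 (n : nat) (hn : (3 <= n)%N) (R : comPzRingType)
    (I : lmodType R) :
  (associated_to_form n I <-> symmetric_structure n I) /\
  (symmetric_structure n I <-> normalized_bases n I).
Proof.
case: n hn => [|[|[|m]]] // _; split; split=> h.
- exact/symmetric_of_normalized_bases/normalized_bases_of_form.
- exact/form_of_normalized_bases/normalized_bases_of_symmetric.
- exact: normalized_bases_of_symmetric.
- exact: symmetric_of_normalized_bases.
Qed.
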